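(* There exists a Schur function $\phi$ such that the composition operator $C_\phi$ is compact on the Hardy-Orlicz space $H^{\Psi_2}$, where $\Psi_2(x)=\exp(x^2)-1$, but $C_\phi$ is not even bounded on $\mathcal{D}_\ast$.
   Context: $\mathbb{D}$ is the open unit disk, $\mathbb{T}=\partial\mathbb{D}$, $A$ is the normalized area measure $dx\,dy/\pi$ on $\mathbb{D}$, and $m$ is the normalized Lebesgue measure on $\mathbb{T}$. A Schur function is an analytic map $\phi\colon\mathbb{D}\to\mathbb{D}$; the associated composition operator is given by $C_\phi(f)=f\circ\phi$. The Dirichlet space $\mathcal{D}$ is the Hilbert space of analytic functions $f\colon\mathbb{D}\to\mathbb{C}$ with $\|f\|_{\mathcal{D}}^2=|f(0)|^2+\int_{\mathbb{D}}|f'|^2\,dA<\infty$, and $\mathcal{D}_\ast$ is its subspace of functions $f\in\mathcal{D}$ with $f(0)=0$. For $\Psi=\Psi_2$, $L^\Psi(\mathbb{T},m)$ is the Orlicz space of measurable functions $f$ with $\int_{\mathbb{T}}\Psi(|f|/C)\,dm<\infty$ for some $C>0$, with Luxemburg norm $\|f\|_\Psi=\inf\{C>0\,;\ \int_{\mathbb{T}}\Psi(|f|/C)\,dm\le1\}$. The Hardy-Orlicz space $H^\Psi$ is the space of $f$ in the Hardy space $H^1$ whose boundary function $f^\ast$ belongs to $L^\Psi(\mathbb{T},m)$, with norm $\|f\|_{H^\Psi}=\|f^\ast\|_\Psi$. *)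

(* Defs.v *)
From HB Require Import structures.
From mathcomp Require Import all_boot all_order all_algebra.
From mathcomp Require Import all_classical all_reals all_analysis.
From mathcomp Require Import complex.

Set Implicit Arguments.
Unset Strict Implicit.
Unset Printing Implicit Defensive.

Import Order.TTheory GRing.Theory Num.Theory.
Import numFieldNormedType.Exports.

Local Open Scope classical_set_scope.
Local Open Scope ring_scope.
Local Open Scope complex_scope.

(* The library attaches the topology of a numFieldType to abstract fields only;
   this is the same topology, for the concrete field R[i]. *)
HB.instance Definition _ (R : realType) :=
  NormedModule.copy (complex R) (complex R)^o.

(* Functions on the open unit disk or on the unit circle are total functions
   R[i] -> R[i]; every notion below depends only on their values there. The
   real-valued modulus is Normc.normc, since `|z| has type R[i]. *)

Section Disk.
Variable R : realType.
Implicit Types (f phi : R[i] -> R[i]).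

Definition disk : set R[i] := [set z | Normc.normc z < 1].

Definition angles : set R := `[0, 2 * pi].

Definition expi (t : R) : R[i] := cos t +i* sin t.

Definition analytic_on_disk f : Prop :=
  forall z0 : R[i], disk z0 ->
    exists (a : nat -> R[i]) (r : R), 0 < r /\
      forall z, Normc.normc (z - z0) < r ->
        series (fun n => a n * (z - z0) ^+ n) @ \oo --> f z.

Definition schur phi : Prop :=
  analytic_on_disk phi /\ forall z, disk z -> disk (phi z).

(* Integral over the disk against dA = dx dy / pi. *)
Definition area_integral (g : R[i] -> \bar R) : \bar R :=
  ((pi^-1)%:E *
   \int[(lebesgue_measure \x lebesgue_measure)%E]_(p in
          [set p : R * R | disk (p.1 +i* p.2)%C]) g (p.1 +i* p.2)%C)%E.

(* Integral over the circle against normalized arc length. *)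
Definition circle_integral (g : R[i] -> \bar R) : \bar R :=
  (((2 * pi)^-1)%:E *
   \int[lebesgue_measure]_(t in angles) g (expi t))%E.

Definition dirichlet_energy f : \bar R :=
  area_integral (fun z => (Normc.normc (derive1 f z) ^+ 2)%:E).

Definition dirichlet f : Prop :=
  analytic_on_disk f /\ (dirichlet_energy f < +oo)%E.

Definition dirichlet_star f : Prop := dirichlet f /\ f 0 = 0.

Definition dirichlet_norm f : R :=
  Num.sqrt (Normc.normc (f 0) ^+ 2 + fine (dirichlet_energy f)).

Definition psi2 (x : R) : R := expR (x ^+ 2) - 1.

Definition orlicz_modular (Psi : R -> R) (g : R[i] -> R[i]) (c : R) : \bar R :=
  circle_integral (fun z => (Psi (Normc.normc (g z) / c))%:E).

Definition circle_measurable (g : R[i] -> R[i]) : Prop :=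
  measurable_fun angles (fun t : R => complex.Re (g (expi t))) /\
  measurable_fun angles (fun t : R => complex.Im (g (expi t))).

Definition orlicz (Psi : R -> R) (g : R[i] -> R[i]) : Prop :=
  circle_measurable g /\ exists c : R, 0 < c /\ (orlicz_modular Psi g c < +oo)%E.

Definition luxemburg_norm (Psi : R -> R) (g : R[i] -> R[i]) : R :=
  inf [set c : R | 0 < c /\ (orlicz_modular Psi g c <= 1)%E].

Definition hardy1 f : Prop :=
  analytic_on_disk f /\
  exists M : R, forall r : R, 0 <= r < 1 ->
    (circle_integral (fun z => (Normc.normc (f (r%:C * z)))%:E) <= M%:E)%E.

(* Radial limit; lim returns a constant junk value where there is none. *)
Definition boundary f (z : R[i]) : R[i] :=
  lim (f (r%:C * z) @[r --> (1 : R)^'-]).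

Definition has_boundary f : Prop :=
  {ae lebesgue_measure, forall t : R, angles t ->
    cvg (f (r%:C * expi t) @[r --> (1 : R)^'-])}.

(* By Fatou's theorem has_boundary holds for every f in H^1; it is recorded
   because it is what makes [boundary f] the boundary function of f. *)
Definition hardy_orlicz (Psi : R -> R) f : Prop :=
  [/\ hardy1 f, has_boundary f & orlicz Psi (boundary f)].

Definition hardy_orlicz_norm (Psi : R -> R) f : R :=
  luxemburg_norm Psi (boundary f).

(* A space of functions is given by a predicate X and its norm N. *)

(* Compactness in sequential form: the image of any sequence of the closed unit
   ball has a subsequence converging in norm to an element of the space. *)
Definition compact_operator (X : set (R[i] -> R[i]))
    (N : (R[i] -> R[i]) -> R) (T : (R[i] -> R[i]) -> (R[i] -> R[i])) : Prop :=
  (forall f, X f -> X (T f)) /\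
  forall u : nat -> (R[i] -> R[i]),
    (forall n, X (u n) /\ N (u n) <= 1) ->
    exists (s : nat -> nat) (g : R[i] -> R[i]),
      [/\ {homo s : m n / (m < n)%N}, X g &
          N (T (u (s n)) \- g) @[n --> \oo] --> (0 : R)].

Definition bounded_operator (X Y : set (R[i] -> R[i]))
    (NX NY : (R[i] -> R[i]) -> R)
    (T : (R[i] -> R[i]) -> (R[i] -> R[i])) : Prop :=
  exists K : R, forall f, X f -> Y (T f) /\ NY (T f) <= K * NX f.

Definition composition_operator phi f : R[i] -> R[i] := f \o phi.

End Disk.

Arguments psi2 {R} x.
Arguments dirichlet {R} f.
Arguments dirichlet_star {R} f.
Arguments dirichlet_norm {R} f.

(* Main.v *)
Require Import Defs.
From mathcomp Require Import all_boot all_order all_algebra.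
From mathcomp Require Import all_classical all_reals all_analysis.
From mathcomp Require Import complex measurable_realfun ring lra zify.

(* The map phi(z) = sum_j 2^-j z^(256^j) / 128 satisfies |phi| <= 1/64 and is
   continuous on the closed disk, but has infinite Dirichlet energy: on a
   rectangle of size 256^-n by 16^-n near 1 its n-th term dominates the others,
   so that |phi'| >= 128^n / 4096 there.  Hence C_phi maps z outside D.

   Compactness on the Hardy-Orlicz space only requires that the unit ball be a
   normal family near 0.  Applying the maximum principle to the product of the
   rotates of f by the N-th roots of unity, then letting N go to infinity, gives
   sqrt|f(0)| <= mean of sqrt|f| over every circle.  For f in the unit ball these
   means are bounded by an absolute constant along some radii tending to 1: as
   |f| has bounded means, sqrt|f(r z)| is uniformly integrable, and its limit is
   controlled by psi2(|f*|).  The same inequality for the iterated quotients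
   (f(z) - f(0)) / z bounds the n-th Taylor coefficient of f by 49 * 16^n.  A
   diagonal extraction then makes u_(s n) o phi converge uniformly.

   Analyticity is handled through Taylor expansions of every order at every
   point, a notion stable under composition; the maximum principle makes it
   equivalent to the local expansion in power series. *)
Set Implicit Arguments.
Unset Strict Implicit.
Unset Printing Implicit Defensive.

Import Order.TTheory GRing.Theory Num.Theory.
Import numFieldNormedType.Exports.

Local Open Scope classical_set_scope.
Local Open Scope ring_scope.
Local Open Scope complex_scope.

Local Notation normc := Normc.normc.

(** * The modulus and convergence in the complex plane *)

Section complex_modulus.
Variable R : realType.
Implicit Types (x y z : R[i]) (r : R).

(** The norm of [hardy_orlicz] sees only radial limits, while [hardy1] bounds the means of |f| by a
    constant depending on f. A bound uniform on the unit ball must travel from the circle into the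
    disk, and bounded means of |f| alone do not let the limit pass under the integral. The square
    root repairs this, and AM-GM applied to a product of moduli gives square roots as easily as the
    moduli themselves. The constant M of each f drops out because it only enters through the mean of
    |f| / M, which is at most 1.

    Constants: passing from f to (f - f(0)) / z multiplies the bound on the mean of sqrt|f| by 4,
    hence 16 per Taylor coefficient, so the normal family lives on |w| < 1/16; a range inside |w| <=
    1/64 leaves the ratio 1/4. In the lacunary series, halving the amplitude while multiplying the
    frequency by 256 multiplies the squared derivative by 128^2 and the area of the rectangle by
    1/4096, a net gain of 4 at each scale. *)

Lemma normc_triangle x y : normc (x + y) <= normc x + normc y.
Proof. by rewrite -lecR rmorphD/=; exact: (@ler_normD _ R[i]). Qed.

Lemma normc_opp x : normc (- x) = normc x.
Proof. by case: x => a b /=; rewrite !sqrrN. Qed.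

Lemma normc_nneg x : 0 <= normc x.
Proof. by case: x => a b; exact: sqrtr_ge0. Qed.

Lemma normc_sub x y : normc (x - y) = normc (y - x).
Proof. by rewrite -normc_opp opprB. Qed.

Lemma normc_triangleB x y : normc (x - y) <= normc x + normc y.
Proof. by rewrite (le_trans (normc_triangle _ _))// normc_opp. Qed.

Lemma normc_triangle_sub x y : normc x - normc y <= normc (x - y).
Proof.
by rewrite lerBlDr (le_trans _ (normc_triangle _ _))// subrK.
Qed.

Lemma normc_real r : normc r%:C = `|r|.
Proof. by rewrite /= expr0n/= addr0 sqrtr_sqr. Qed.

Lemma normc_subrr z r : 0 < r -> normc (z - z) < r.
Proof. by rewrite subrr Normc.normc0. Qed.

Lemma normc_exp x n : normc (x ^+ n) = normc x ^+ n.
Proof.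
elim: n => [|n IH]; first by rewrite !expr0 Normc.normc1.
by rewrite !exprS Normc.normcM IH.
Qed.

Lemma normc_eq0 x : (normc x == 0) = (x == 0).
Proof.
by apply/eqP/eqP => [/Normc.eq0_normc//|->]; rewrite Normc.normc0.
Qed.

Lemma normc_gt0 x : (0 < normc x) = (x != 0).
Proof. by rewrite lt_def normc_nneg normc_eq0 andbT. Qed.

Lemma normc_sum (I : Type) (s : seq I) (P : pred I) (F : I -> R[i]) :
  normc (\sum_(i <- s | P i) F i) <= \sum_(i <- s | P i) normc (F i).
Proof.
elim/big_ind2 : _ => [|a b c d ab cd|//]; first by rewrite Normc.normc0.
by rewrite (le_trans (normc_triangle _ _))// lerD.
Qed.

Lemma normc_prod (I : Type) (s : seq I) (P : pred I) (F : I -> R[i]) :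
  normc (\prod_(i <- s | P i) F i) = \prod_(i <- s | P i) normc (F i).
Proof. exact: (big_morph _ (@Normc.normcM R) (@Normc.normc1 R)). Qed.

Lemma Re_le_normc z : `|complex.Re z| <= normc z.
Proof.
by case: z => a b /=; rewrite -sqrtr_sqr ler_sqrt ?lerDl ?addr_ge0 ?sqr_ge0.
Qed.

Lemma Im_le_normc z : `|complex.Im z| <= normc z.
Proof.
by case: z => a b /=; rewrite -sqrtr_sqr ler_sqrt ?lerDr ?addr_ge0 ?sqr_ge0.
Qed.

Lemma normc_le_ReIm z : normc z <= `|complex.Re z| + `|complex.Im z|.
Proof.
case: z => a b /=; rewrite -(ler_pXn2r (n := 2)) ?nnegrE ?sqrtr_ge0 ?addr_ge0//.
rewrite sqr_sqrtr ?addr_ge0 ?sqr_ge0// sqrrD !real_normK ?num_real//.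
by rewrite addrAC lerDl mulrn_wge0// mulr_ge0.
Qed.

Lemma normc_sqr a b : normc (a +i* b : R[i]) ^+ 2 = a ^+ 2 + b ^+ 2.
Proof. by rewrite /= sqr_sqrtr ?addr_ge0 ?sqr_ge0. Qed.

Lemma cvg_normcP (T : Type) (F : set_system T) {FF : Filter F}
    (f : T -> R[i]) (l : R[i]) :
  f @ F --> l <->
  forall e : R, 0 < e -> \forall x \near F, normc (l - f x) < e.
Proof.
split=> [/cvgrPdist_lt h e e0|h].
  have : (0 : R[i]) < e%:C by rewrite ltcR.
  by move=> /h; apply: filterS => x; rewrite ltcR.
apply/cvgrPdist_lt => -[e d] e0.
(* In the order of [R[i]] a positive element is a positive real, so complex and real tolerances are
   interchangeable. *)
have [de e1] : d = 0 /\ 0 < e.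
  by move: e0; rewrite ltcE/= => /andP[/eqP].
rewrite de; apply: filterS (h _ e1) => x.
by rewrite -ltcR.
Qed.

Lemma cvgn_normcP (u : nat -> R[i]) (l : R[i]) :
  u @ \oo --> l <->
  forall e : R, 0 < e -> exists N, forall n, (N <= n)%N -> normc (l - u n) < e.
Proof.
split=> [/cvg_normcP h e /h [N _ hN]|h]; first by exists N => n /hN.
apply/cvg_normcP => e /h [N hN]; exists N => // n /=; exact: hN.
Qed.

Lemma cvgn_normc_le (u : nat -> R[i]) (l : R[i]) (M : R) (N : nat) :
  (forall n, (N <= n)%N -> normc (u n) <= M) -> u @ \oo --> l -> normc l <= M.
Proof.
move=> uM /cvgn_normcP h; apply/ler_addgt0Pl => e /h [n hn].
have := hn (maxn n N) (leq_maxl _ _); have := uM (maxn n N) (leq_maxr _ _).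
set v := u _ => v1 v2; rewrite -(subrK v l).
by rewrite (le_trans (normc_triangle _ _))// lerD// ltW.
Qed.

Lemma cvgn_unique (u : nat -> R[i]) (l l' : R[i]) :
  u @ \oo --> l -> u @ \oo --> l' -> l = l'.
Proof.
move=> /cvgn_normcP h /cvgn_normcP h'; apply/eqP; rewrite -subr_eq0 -normc_eq0.
rewrite eq_le normc_nneg andbT; apply/ler_addgt0Pl => e e0; rewrite addr0.
have e2 : 0 < e / 2 by rewrite divr_gt0.
have [N hN] := h _ e2; have [N' hN'] := h' _ e2.
have := hN _ (leq_maxl N N'); have := hN' _ (leq_maxr N N').
set v := u _ => v1 v2; rewrite (_ : l - l' = (l - v) - (l' - v)); last by ring.
by rewrite (le_trans (normc_triangleB _ _))// (splitr e) lerD// ltW.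
Qed.

End complex_modulus.

Opaque Normc.normc.

(** * Taylor expansions *)

Section jets.
Variable R : realType.
Implicit Types (f g phi : R[i] -> R[i]) (z : R[i]).

(* A Taylor expansion of order n at z0: f has n successive divided differences
   at z0, the last of which is bounded near z0. *)
Fixpoint jet n f z0 : Prop :=
  if n is m.+1 then
    exists g, jet m g z0 /\ exists d : R, 0 < d /\
      forall z, normc (z - z0) < d -> f z = f z0 + (z - z0) * g z
  else exists (M d : R), 0 < d /\ forall z, normc (z - z0) < d -> normc (f z) <= M.

Lemma jet_local n f g z0 (d : R) : 0 < d ->
  (forall z, normc (z - z0) < d -> f z = g z) -> jet n f z0 -> jet n g z0.
Proof.
move=> d0 fg; case: n => [|n] /=.
  move=> [M [e [e0 h]]]; exists M, (Num.min d e); split; first by rewrite lt_min d0.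
  by move=> z; rewrite lt_min => /andP[/fg <-]; exact: h.
move=> [h [hj [e [e0 hh]]]]; exists h; split => //; exists (Num.min d e).
split; first by rewrite lt_min d0.
move=> z; rewrite lt_min => /andP[zd ze]; by rewrite -(fg z zd) -(fg z0) ?(normc_subrr _ d0)// hh.
Qed.

Lemma jet_continuous f z0 : jet 1 f z0 -> forall e : R, 0 < e ->
  exists d : R, 0 < d /\ forall z, normc (z - z0) < d -> normc (f z - f z0) < e.
Proof.
move=> [g [[M [d [d0 gM]]] [d' [d'0 h]]]] e e0.
have M0 : 0 <= M.
  by rewrite (le_trans (normc_nneg (g z0)))// gM// subrr Normc.normc0.
have M1 : 0 < M + 1 by rewrite ltr_wpDl.
exists (Num.min (Num.min d d') (e / (M + 1))); split.
  by rewrite !lt_min d0 d'0 divr_gt0.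
move=> z; rewrite !lt_min => /andP[/andP[zd zd']]; rewrite ltr_pdivlMr// => ze.
rewrite h// addrAC subrr add0r Normc.normcM (le_lt_trans _ ze)//.
by rewrite ler_wpM2l ?normc_nneg// ler_wpDr// gM.
Qed.

Lemma jetW n f z0 : jet n.+1 f z0 -> jet n f z0.
Proof.
elim: n f => [|n IH] f.
  move=> fj; have [d [d0 h]] := jet_continuous fj ltr01.
  exists (1 + normc (f z0)), d; split => // z /h hz.
  by rewrite -lerBlDr (le_trans (normc_triangle_sub _ _))// ltW.
by move=> [g [gj h]]; exists g; split => //; exact: IH.
Qed.

Lemma jet_le m n f z0 : (m <= n)%N -> jet n f z0 -> jet m f z0.
Proof.
move=> /subnK <-; elim: (n - m)%N => //= k IH h; exact/IH/jetW.
Qed.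

Lemma jet_cst n (c : R[i]) z0 : jet n (fun=> c) z0.
Proof.
elim: n c => [|n IH] c; first by exists (normc c), 1.
exists (fun=> 0); split => //; exists 1; split => // z _; by rewrite mulr0 addr0.
Qed.

Lemma jet_id n z0 : jet n id z0.
Proof.
apply: jetW; exists (fun=> 1); split; first exact: jet_cst.
by exists 1; split => // z _; rewrite mulr1 addrC subrK.
Qed.

Lemma jetD n f g z0 : jet n f z0 -> jet n g z0 -> jet n (fun z => f z + g z) z0.
Proof.
elim: n f g => [|n IH] f g.
  move=> [M [d [d0 fM]]] [M' [d' [d'0 gM]]]; exists (M + M'), (Num.min d d').
  split; first by rewrite lt_min d0.
  move=> z; rewrite lt_min => /andP[zd zd'].
  by rewrite (le_trans (normc_triangle _ _))// lerD ?fM ?gM.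
move=> [f1 [fj [d [d0 fM]]]] [g1 [gj [d' [d'0 gM]]]].
exists (fun z => f1 z + g1 z); split; first exact: IH.
exists (Num.min d d'); split; first by rewrite lt_min d0.
by move=> z; rewrite lt_min => /andP[zd zd']; rewrite fM// gM//; ring.
Qed.

Lemma jetM n f g z0 : jet n f z0 -> jet n g z0 -> jet n (fun z => f z * g z) z0.
Proof.
elim: n f g => [|n IH] f g.
  move=> [M [d [d0 fM]]] [M' [d' [d'0 gM]]]; exists (M * M'), (Num.min d d').
  split; first by rewrite lt_min d0.
  move=> z; rewrite lt_min => /andP[zd zd'].
  by rewrite Normc.normcM ler_pM ?normc_nneg ?fM ?gM.
move=> fj gj; have gn := jetW gj.
move: fj gj => [f1 [fj [d [d0 fM]]]] [g1 [gj [d' [d'0 gM]]]].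
(* f g - f(z0) g(z0) = f(z0) (g - g(z0)) + (f - f(z0)) g; the last factor is [g] itself, hence the
   order n kept in [gn]. *)
exists (fun z => f z0 * g1 z + f1 z * g z); split.
  by apply: jetD; apply: IH => //; exact: jet_cst.
exists (Num.min d d'); split; first by rewrite lt_min d0.
move=> z; rewrite lt_min => /andP[zd zd'].
by rewrite {1}fM// mulrDl {1}gM//; ring.
Qed.

Lemma jetB n f g z0 : jet n f z0 -> jet n g z0 -> jet n (fun z => f z - g z) z0.
Proof.
move=> fj gj; apply: (@jet_local _ (fun z => f z + (-1) * g z) _ _ 1) => //.
  by move=> z _; rewrite mulN1r.
by apply: jetD => //; apply: jetM => //; exact: jet_cst.
Qed.

(** One more order is asked of [phi]: at order 0, f is bounded only near [phi z0], and continuity of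
    [phi] is what keeps [phi z] there. The inductive step is the chain rule for divided
    differences. *)
Lemma jet_comp n f phi z0 :
  jet n f (phi z0) -> jet n.+1 phi z0 -> jet n (fun z => f (phi z)) z0.
Proof.
elim: n f => [|n IH] f fj pj.
  move: fj => [M [d [d0 fM]]]; have [e [e0 h]] := jet_continuous pj d0.
  by exists M, e; split => // z /h; exact: fM.
have pj1 := jetW pj.
move: fj => [f1 [fj [d [d0 fM]]]].
have [e [e0 h]] := jet_continuous (jet_le (ltn0Sn _) pj) d0.
move: pj => [p1 [p1j [d' [d'0 pM]]]].
exists (fun z => p1 z * f1 (phi z)); split.
  by apply: jetM; [exact: jetW|exact: IH].
exists (Num.min e d'); split; first by rewrite lt_min e0.
move=> z; rewrite lt_min => /andP[ze zd].
by rewrite (fM _ (h _ ze)) {1}(pM _ zd); ring.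
Qed.

Lemma jet_inv n z0 : z0 != 0 -> jet n (fun z => z^-1) z0.
Proof.
move=> z00; have nz0 : 0 < normc z0 by rewrite normc_gt0.
have d0 : 0 < normc z0 / 2 by rewrite divr_gt0.
have nz z : normc (z - z0) < normc z0 / 2 -> normc z0 / 2 < normc z.
  rewrite normc_sub => /(le_lt_trans (normc_triangle_sub _ _)); lra.
elim: n => [|n IH].
  exists (normc z0 / 2)^-1, (normc z0 / 2); split => // z /nz h.
  by rewrite Normc.normcV lef_pV2 ?posrE// ?ltW// (lt_trans d0).
(* 1/z - 1/z0 = (z - z0) (-1 / (z0 z)): the divided difference is again a multiple of the inverse,
   so the induction closes. *)
exists (fun z => (- z0^-1) * z^-1); split.
  by apply: jetM => //; exact: jet_cst.
exists (normc z0 / 2); split => // z /nz h.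
have {}h : z != 0 by rewrite -normc_gt0 (lt_trans d0).
by field; rewrite ?z00 ?h.
Qed.

Definition smooth f z := forall n, jet n f z.

(** A term is the difference of two consecutive partial sums: at most 2 once both are within 1 of
    the limit, and the finitely many earlier terms are dominated by their sum. *)
Lemma pseries_coef_bound (a : nat -> R[i]) (z l : R[i]) :
  series (fun n => a n * z ^+ n) @ \oo --> l ->
  exists K : R, forall n, normc (a n) * normc z ^+ n <= K.
Proof.
move=> /cvgn_normcP /(_ 1 ltr01) [N hN].
exists (2 + \sum_(i < N) normc (a i) * normc z ^+ i) => n.
have S0 (P : pred 'I_N) : 0 <= \sum_(i < N | P i) normc (a i) * normc z ^+ i.
  by apply: sumr_ge0 => i _; rewrite mulr_ge0 ?normc_nneg// exprn_ge0// normc_nneg.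
case: (ltnP n N) => nN.
  by rewrite (bigD1 (Ordinal nN))//= addrCA lerDl addr_ge0.
rewrite ler_wpDr// -normc_exp -Normc.normcM.
have -> : a n * z ^+ n =
    (l - series (fun n => a n * z ^+ n) n) - (l - series (fun n => a n * z ^+ n) n.+1).
  by rewrite (seriesSr _ n) /=; ring.
rewrite (le_trans (normc_triangleB _ _))// (_ : 2 = 1 + 1)// lerD// ltW// hN//.
exact: leqW.
Qed.

Lemma geometric_sum_le (q : R) n : 0 <= q < 1 -> \sum_(i < n) q ^+ i <= (1 - q)^-1.
Proof.
move=> /andP[q0 q1]; have q2 : 0 < 1 - q by rewrite subr_gt0.
rewrite -[leRHS]mul1r ler_pdivlMr// mulrC.
have -> : (1 - q) * \sum_(i < n) q ^+ i = 1 - q ^+ n.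
  by rewrite -opprB mulNr -subrX1 opprB.
by rewrite lerBlDr lerDl exprn_ge0.
Qed.
End jets.

(** * Power series *)

Section power_series.
Variable R : realType.
Implicit Types (f g : R[i] -> R[i]) (z h : R[i]) (c : nat -> R[i]) (K rho q : R).

Lemma cvg_ReIm (T : Type) (F : set_system T) {FF : Filter F}
    (f : T -> R[i]) (a b : R) :
  (fun x => complex.Re (f x)) @ F --> a -> (fun x => complex.Im (f x)) @ F --> b ->
  f @ F --> (a +i* b).
Proof.
move=> /cvgrPdist_lt ha /cvgrPdist_lt hb; apply/cvg_normcP => e e0.
have e2 : 0 < e / 2 by rewrite divr_gt0.
apply: filterS2 (ha _ e2) (hb _ e2) => x; case: (f x) => u v /= h1 h2.
rewrite (le_lt_trans (normc_le_ReIm _))//= (splitr e); exact: ltrD.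
Qed.

Lemma Re_sum (I : Type) (s : seq I) (F : I -> R[i]) :
  complex.Re (\sum_(i <- s) F i) = \sum_(i <- s) complex.Re (F i).
Proof. by apply: (big_morph (@complex.Re R)) => // -[a b] [c d]. Qed.

Lemma Im_sum (I : Type) (s : seq I) (F : I -> R[i]) :
  complex.Im (\sum_(i <- s) F i) = \sum_(i <- s) complex.Im (F i).
Proof. by apply: (big_morph (@complex.Im R)) => // -[a b] [c d]. Qed.

Lemma cvg_dominated_series (u : nat -> R[i]) (v : nat -> R) :
  (forall n, normc (u n) <= v n) -> cvgn (series v) -> cvgn (series u).
Proof.
move=> uv cv.
have D (w : nat -> R) : (forall n, `|w n| <= v n) -> cvgn (series w).
  move=> wv; apply: normed_cvg; apply: series_le_cvg cv => n /=; [by []| |exact: wv].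
  exact: le_trans (normr_ge0 _) (wv n).
have cR := D _ (fun n => le_trans (Re_le_normc _) (uv n)).
have cI := D _ (fun n => le_trans (Im_le_normc _) (uv n)).
apply/cvg_ex; exists (limn (series (fun n => complex.Re (u n))) +i*
  limn (series (fun n => complex.Im (u n)))).
apply: cvg_ReIm.
  rewrite [X in X @ _ --> _](_ : _ = series (fun n => complex.Re (u n)))//.
  by apply/funext => n; rewrite /series /= Re_sum.
rewrite [X in X @ _ --> _](_ : _ = series (fun n => complex.Im (u n)))//.
by apply/funext => n; rewrite /series /= Im_sum.
Qed.

Definition coef_bound c rho K := forall n, normc (c n) * rho ^+ n <= K.

Definition psum c z : R[i] := lim (series (fun n => c n * z ^+ n) @ \oo).

Lemma coef_bound_term c rho K z n : 0 < rho -> coef_bound c rho K ->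
  normc (c n * z ^+ n) <= K * (normc z / rho) ^+ n.
Proof.
move=> r0 cK; rewrite Normc.normcM normc_exp.
have -> : normc (c n) * normc z ^+ n =
    (normc (c n) * rho ^+ n) * (normc z / rho) ^+ n.
  by rewrite -mulrA -exprMn [rho * _]mulrC divfK ?gt_eqF.
by rewrite ler_wpM2r// exprn_ge0// divr_ge0 ?normc_nneg// ltW.
Qed.

Lemma ratio_lt1 z rho : normc z < rho -> 0 < rho /\ 0 <= normc z / rho < 1.
Proof.
move=> zr; have r0 : 0 < rho := le_lt_trans (normc_nneg _) zr.
by rewrite divr_ge0 ?normc_nneg ?(ltW r0)//= ltr_pdivrMr// mul1r.
Qed.

Lemma psum_cvg c rho K z : coef_bound c rho K -> normc z < rho ->
  series (fun n => c n * z ^+ n) @ \oo --> psum c z.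
Proof.
move=> cK /ratio_lt1[r0 /andP[q0 q1]].
suff : cvgn (series (fun n => c n * z ^+ n)) by [].
apply: (@cvg_dominated_series _ (geometric K (normc z / rho))) => [n|].
  exact: coef_bound_term.
by apply: is_cvg_geometric_series; rewrite ger0_norm.
Qed.

Lemma psum_tail c rho K z l m : coef_bound c rho K -> normc z < rho ->
  series (fun n => c n * z ^+ n) @ \oo --> l ->
  normc (l - \sum_(i < m) c i * z ^+ i) <=
    K * (normc z / rho) ^+ m / (1 - normc z / rho).
Proof.
move=> cK /ratio_lt1[r0 qq]; have /andP[q0 q1] := qq.
set q := normc z / rho; move=> /cvgn_normcP h.
have K0 : 0 <= K by rewrite (le_trans _ (cK 0))// mulr_ge0 ?normc_nneg// exprn_ge0 ?ltW.
apply: (@cvgn_normc_le _ (fun n => series (fun n => c n * z ^+ n) n -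
   \sum_(i < m) c i * z ^+ i) _ _ m).
  move=> n mn; rewrite /series/= big_mkord -(subnKC mn) big_split_ord/= addrAC subrr add0r.
  rewrite (le_trans (normc_sum _ _ _))//.
  apply: (@le_trans _ _ ((K * q ^+ m) * \sum_(i < n - m) q ^+ i)); last first.
    by rewrite ler_wpM2l ?mulr_ge0 ?exprn_ge0// geometric_sum_le.
  rewrite mulr_sumr ler_sum// => i _.
  by rewrite -mulrA -exprD; exact: coef_bound_term.
apply/cvgn_normcP => e /h [N hN]; exists N => n /hN.
by rewrite (_ : _ - _ - _ = l - series (fun n => c n * z ^+ n) n)//; ring.
Qed.

Lemma psum_shift c z l l1 :
  series (fun n => c n * z ^+ n) @ \oo --> l ->
  series (fun n => c n.+1 * z ^+ n) @ \oo --> l1 -> l = c 0 + z * l1.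
Proof.
move=> hl /cvgn_normcP h1; apply: cvgn_unique hl _; apply/cvgn_normcP => e e0.
have Z0 : 0 < normc z + 1 by rewrite ltr_wpDl ?normc_nneg.
have [N hN] := h1 _ (divr_gt0 e0 Z0); exists N.+1 => -[//|n] /hN.
rewrite /series/= big_nat_recl// expr0 mulr1 ltr_pdivlMr// => h.
rewrite (_ : _ - _ = z * (l1 - \sum_(0 <= k < n) c k.+1 * z ^+ k)).
  rewrite Normc.normcM mulrC (le_lt_trans _ h)// ler_wpM2l ?normc_nneg//.
  by rewrite lerDl.
rewrite mulrBr mulr_sumr opprD addrACA subrr add0r; congr (_ - _).
by apply: eq_bigr => i _; rewrite exprS; ring.
Qed.

Lemma psum0 c l : series (fun n => c n * 0 ^+ n) @ \oo --> l -> l = c 0.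
Proof.
move=> hl; apply: cvgn_unique hl _; apply/cvgn_normcP => e e0; exists 1%N => -[//|n] _.
rewrite /series/= big_nat_recl// expr0 mulr1 big1 ?addr0 ?normc_subrr// => i _.
by rewrite expr0n/= mulr0.
Qed.

Lemma psum_quotient c z l : z != 0 ->
  series (fun n => c n * z ^+ n) @ \oo --> l ->
  series (fun n => c n.+1 * z ^+ n) @ \oo --> (l - c 0) / z.
Proof.
move=> z0 /cvgn_normcP h; apply/cvgn_normcP => e e0.
have nz0 : 0 < normc z by rewrite normc_gt0.
have [N hN] := h _ (mulr_gt0 e0 nz0); exists N => n Nn.
have := hN n.+1 (leqW Nn); rewrite /series/= big_nat_recl// expr0 mulr1.
rewrite -ltr_pdivrMr// -Normc.normcV -Normc.normcM.
set s := \sum_(_ <= _ < _) _; set t := \sum_(_ <= _ < _) _.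
have -> : s = z * t by rewrite mulr_sumr; apply: eq_bigr => i _; rewrite exprS; ring.
by rewrite (_ : (l - (c 0 + z * t)) / z = (l - c 0) / z - t)//; field.
Qed.

(** At the center the divided difference is the series with shifted coefficients, completed by [c 1]
    at z0. At order 0, convergence at the single point z0 + r/2 bounds the coefficients, and the
    ratio 1/2 on the disk of radius r/4 makes the geometric factor at most 2. *)
Lemma jet_pseries_center f c z0 (r : R) n : 0 < r ->
  (forall z, normc (z - z0) < r ->
    series (fun n => c n * (z - z0) ^+ n) @ \oo --> f z) -> jet n f z0.
Proof.
move=> r0; elim: n f c => [|n IH] f c fc.
  have r2 : 0 < r / 2 by rewrite divr_gt0.
  pose z1 := z0 + (r / 2)%:C.
  have e1 : z1 - z0 = (r / 2)%:C by rewrite /z1 addrAC subrr add0r.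
  have : normc (z1 - z0) < r by rewrite e1 normc_real gtr0_norm//; lra.
  move=> /fc/pseries_coef_bound[K]; rewrite e1 normc_real gtr0_norm// => cK.
  have K0 : 0 <= K by rewrite (le_trans _ (cK 0))// mulr_ge0 ?normc_nneg// exprn_ge0 ?ltW.
  exists (K * 2), (r / 4); split => [|z zr]; first by rewrite divr_gt0.
  have zr2 : normc (z - z0) < r / 2 by rewrite (lt_le_trans zr)//; lra.
  have zr1 : normc (z - z0) < r by rewrite (lt_le_trans zr)//; lra.
  have := psum_tail 0 cK zr2 (fc _ zr1).
  rewrite big_ord0 subr0 expr0 mulr1 => /le_trans; apply.
  rewrite ler_wpM2l// -[leRHS]invrK lef_pV2 ?posrE ?invr_gt0//.
    have : normc (z - z0) / (r / 2) <= 1 / 2 by rewrite ler_pdivrMr//; lra.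
    by lra.
  by rewrite subr_gt0 ltr_pdivrMr ?mul1r.
have f0 : f z0 = c 0.
  by have /(fc z0) := normc_subrr z0 r0; rewrite subrr => /psum0.
exists (fun z => if z == z0 then c 1%N else (f z - f z0) / (z - z0)); split.
  apply: (IH _ (fun n => c n.+1)) => z /fc h.
  case: eqP h => [->|/eqP]; last by rewrite -subr_eq0 f0 => z00; exact: psum_quotient.
  rewrite subrr => _; apply/cvgn_normcP => e e0; exists 1%N => -[//|m] _.
  rewrite /series/= big_nat_recl// expr0 mulr1 big1 ?addr0 ?normc_subrr// => i _.
  by rewrite expr0n/= mulr0.
exists r; split => // z _; case: eqP => [->|/eqP]; first by rewrite subrr mul0r addr0.
by rewrite -subr_eq0 => z00; field.
Qed.

(* The divided difference of f at z0 is the power series with coefficients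
   e (k + 1), where e m = sum_j c_(m + j) z0^j. *)
Lemma jet_pseries f c rho K z0 n : coef_bound c rho K -> normc z0 < rho ->
  (forall z, normc z < rho -> series (fun n => c n * z ^+ n) @ \oo --> f z) ->
  jet n f z0.
Proof.
move=> + z0r; have [r0 /andP[q0 q1]] := ratio_lt1 z0r.
elim: n f c K => [|n IH] f c K cK fc.
  exists (K / (1 - (normc z0 + rho) / 2 / rho)), ((rho - normc z0) / 2).
  split=> [|z]; first by rewrite divr_gt0// subr_gt0.
  move=> /(le_lt_trans (normc_triangle_sub _ _)) zz.
  have zr : normc z < rho by lra.
  have K0 : 0 <= K by rewrite (le_trans _ (cK 0))// mulr_ge0 ?normc_nneg// exprn_ge0 ?ltW.
  have := psum_tail 0 cK zr (fc _ zr).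
  rewrite big_ord0 subr0 expr0 mulr1 => /le_trans; apply.
  rewrite ler_wpM2l// lef_pV2 ?posrE ?subr_gt0 ?ltr_pdivrMr ?mul1r//; last by lra.
  by rewrite lerB// ler_wpM2r ?invr_ge0 ?(ltW r0)//; lra.
pose e m := psum (fun j => c (m + j)%N) z0.
have ecb m : coef_bound (fun j => c (m + j)%N) rho (K / rho ^+ m).
  move=> j; rewrite ler_pdivlMr ?exprn_gt0// -mulrA -exprD addnC; exact: cK.
have ecvg m := psum_cvg (ecb m) z0r.
have eS m : e m = c m + z0 * e m.+1.
  rewrite -[in c m](addn0 m); apply: psum_shift (ecvg m) _.
  have := ecvg m.+1; rewrite (_ : (fun j => _) = (fun j => c (m + j.+1)%N * z0 ^+ j))//.
  by apply/funext => j; rewrite addSnnS.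
have e0 : f z0 = e 0 by apply: cvgn_unique (fc _ z0r) (ecvg 0).
set q := normc z0 / rho.
have ebound : coef_bound e rho (K / (1 - q)).
  move=> m; have := psum_tail 0 (ecb m) z0r (ecvg m).
  rewrite big_ord0 subr0 expr0 mulr1 -ler_pdivlMr ?exprn_gt0// => /le_trans; apply.
  by rewrite le_eqVlt; apply/orP; left; apply/eqP; rewrite -/q; ring.
have dbound : coef_bound (fun m => e m.+1) rho (K / (1 - q) / rho).
  by move=> m; rewrite ler_pdivlMr// -mulrA -exprSr.
exists (psum (fun m => e m.+1)); split.
  by apply: (IH _ _ _ dbound) => z; exact: psum_cvg dbound.
exists (rho - normc z0); split => [|z]; first by rewrite subr_gt0.
move=> /(le_lt_trans (normc_triangle_sub _ _)) zz.
have zr : normc z < rho by lra.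
have [_ qq] := ratio_lt1 zr.
apply/eqP; rewrite -subr_eq0; apply/eqP.
(* Summation by parts from [eS]. The boundary term [e m * z ^+ m] tends to 0 because |z| < rho, so
   the limit in m is the divided difference identity. *)
have part m : (z - z0) * \sum_(i < m) e i.+1 * z ^+ i =
    \sum_(i < m) c i * z ^+ i + e m * z ^+ m - f z0.
  elim: m => [|m IHm]; first by rewrite !big_ord0 mulr0 e0 expr0; ring.
  by rewrite !big_ord_recr/= mulrDr IHm (eS m) exprS; ring.
apply/eqP; rewrite -normc_eq0 eq_le normc_nneg andbT; apply/ler_addgt0Pl => eps eps0.
rewrite addr0.
have /cvgn_normcP/(_ (eps / 3)) := fc _ zr; case; first by rewrite divr_gt0.
move=> N1 h1.
have /cvgn_normcP/(_ (eps / 3 / (normc (z - z0) + 1))) := psum_cvg dbound zr.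
have Z0 : 0 < normc (z - z0) + 1 by rewrite ltr_wpDl ?normc_nneg.
case; first by rewrite !divr_gt0.
move=> N2 h2.
have : geometric (K / (1 - q)) (normc z / rho) @ \oo --> (0 : R).
  by apply: cvg_geometric; rewrite ger0_norm; case/andP: qq.
move=> /cvgrPdist_lt/(_ (eps / 3)); case; first by rewrite divr_gt0.
move=> N3 _ h3; pose m := maxn N1 (maxn N2 N3).
have {}h1 := h1 m (leq_maxl _ _).
have {}h2 := h2 m (leq_trans (leq_maxl _ _) (leq_maxr _ _)).
have {}h3 : normc (e m * z ^+ m) < eps / 3.
  apply: le_lt_trans (coef_bound_term _ _ r0 ebound) _.
  have := h3 m (leq_trans (leq_maxr _ _) (leq_maxr _ _)).
  by rewrite /= sub0r normrN; apply: le_lt_trans; rewrite ler_norm.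
move: h1 h2; rewrite /series/= !big_mkord => h1; rewrite ltr_pdivlMr// => h2.
set F := f z in h1 *; set P := psum _ z in h2 *.
rewrite (_ : F - _ = (F - \sum_(i < m) c i * z ^+ i) - (z - z0) *
   (P - \sum_(i < m) e i.+1 * z ^+ i) - e m * z ^+ m); last first.
  by rewrite mulrBr part; ring.
rewrite (le_trans (normc_triangleB _ _))//.
have -> : eps = eps / 3 + eps / 3 + eps / 3 by lra.
rewrite lerD ?(ltW h3)//; apply: ltW; rewrite (le_lt_trans (normc_triangleB _ _))//.
rewrite ltrD// Normc.normcM mulrC (le_lt_trans _ h2)// ler_wpM2l ?normc_nneg//.
by rewrite lerDl.
Qed.

End power_series.

(** * The maximum principle and analyticity *)

Section max_principle.
Variable R : realType.
Implicit Types (f g : R[i] -> R[i]) (z h : R[i]) (r s t : R).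

Lemma expi_norm t : normc (expi t) = 1.
Proof.
have : normc (expi t) ^+ 2 = 1 by rewrite normc_sqr cos2Dsin2.
by move/eqP; rewrite sqrp_eq1 ?normc_nneg// => /eqP.
Qed.

Lemma normc_polar r t : 0 <= r -> normc (r%:C * expi t) = r.
Proof. by move=> r0; rewrite Normc.normcM expi_norm mulr1 normc_real ger0_norm. Qed.

Lemma expi0 : expi 0 = 1 :> R[i].
Proof. by rewrite /expi cos0 sin0. Qed.

Lemma expiD s t : expi (s + t) = expi s * expi t :> R[i].
Proof. by rewrite /expi cosD sinD; congr (_ +i* _); ring. Qed.

Lemma expi2pi : expi (2 * pi) = 1 :> R[i].
Proof. by rewrite /expi mulr_natl cos2pi sin2pi. Qed.

Lemma polar_form z : exists t, 0 <= t <= 2 * pi /\ z = (normc z)%:C * expi t.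
Proof.
have pi0 := pi_ge0 R.
have [->|z0] := eqVneq z 0.
  by exists 0; rewrite Normc.normc0 mul0r; split => //; lra.
have n0 : normc z != 0 by rewrite normc_eq0.
have n1 : 0 < normc z by rewrite normc_gt0.
have := normc_sqr (complex.Re z) (complex.Im z).
rewrite (_ : complex.Re z +i* complex.Im z = z); last by case: (z).
set a := complex.Re z / normc z; set b := complex.Im z / normc z => nab.
have ab : a ^+ 2 + b ^+ 2 = 1.
  by rewrite /a /b !expr_div_n -mulrDl -nab divff// expf_neq0.
have a1 : -1 <= a <= 1.
  by rewrite -ler_norml -(ler_pXn2r (n := 2)) ?nnegrE// real_normK ?num_real// expr1n -ab lerDl sqr_ge0.
have ze : z = (normc z)%:C * (a +i* b).
  by case: (z) @a @b n0 {n1 nab ab a1 z0} => u v /= n0; apply/eqP; rewrite eq_complex/=;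
    apply/andP; split; apply/eqP; field.
have [ha ca] := acos_def a1.
have sb : sin (acos a) = `|b|.
  by rewrite sin_acos// -ab addrAC subrr add0r sqrtr_sqr.
have [b0|b0] := leP 0 b.
  exists (acos a); split; first by case/andP: ha => h1 h2; apply/andP; split; lra.
  by rewrite [LHS]ze /expi ca sb ger0_norm.
exists (2 * pi - acos a); split; first by case/andP: ha => h1 h2; apply/andP; split; lra.
rewrite [LHS]ze /expi (_ : 2 * pi = pi *+ 2); last by rewrite mulr2n; lra.
by rewrite cosB sinB cos2pi sin2pi ca sb ltr0_norm//; congr (_ * (_ +i* _)); lra.
Qed.

Lemma expi_continuous t (e : R) : 0 < e ->
  \forall s \near t, normc (expi s - expi t) < e.
Proof.
move=> e0.
have h : expi s @[s --> t] --> expi t.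
  by apply: cvg_ReIm => /=; [exact: continuous_cos|exact: continuous_sin].
have /cvg_normcP/(_ _ e0) := h.
by apply: filterS => s; rewrite normc_sub.
Qed.

Definition continuous_at_pt (G : R[i] -> R) z0 := forall e : R, 0 < e ->
  exists d : R, 0 < d /\ forall z, normc (z - z0) < d -> `|G z - G z0| < e.

(** Polar coordinates present the closed disk as the image of a compact rectangle, on which the
    extreme value theorem applies. *)
Lemma closed_disk_max (G : R[i] -> R) r : 0 <= r ->
  (forall z, normc z <= r -> continuous_at_pt G z) ->
  exists z0, normc z0 <= r /\ forall z, normc z <= r -> G z <= G z0.
Proof.
move=> r0 Gc.
pose A : set (R * R) := `[0, r] `*` `[0, 2 * pi].
pose P (p : R * R) : R[i] := (p.1)%:C * expi p.2.
have nP p : A p -> normc (P p) <= r.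
  by move=> [] /=; rewrite !in_itv/= => /andP[p0 p1] _; rewrite normc_polar.
have [|||p] := @compact_EVT_max _ R (G \o P) A.
- by exists (0, 0); split; rewrite /= in_itv/= lexx ?r0// mulr_ge0// pi_ge0.
- by apply: compact_setX; exact: segment_compact.
- apply: continuous_in_subspaceT => p; rewrite inE => Ap.
  apply/cvgrPdist_lt => e e0.
  have [d [d0 hd]] := Gc _ (nP _ Ap) _ e0.
  have hP : P q @[q --> p] --> P p.
    have e1 : (fun q : R * R => complex.Re (P q)) = (fun q => q.1 * cos q.2).
      by apply/funext => q; rewrite /P /expi/=; ring.
    have e2 : (fun q : R * R => complex.Im (P q)) = (fun q => q.1 * sin q.2).
      by apply/funext => q; rewrite /P /expi/=; ring.
    have -> : P p = (p.1 * cos p.2) +i* (p.1 * sin p.2).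
      by rewrite /P /expi; simpc; congr (_ +i* _); ring.
    apply: cvg_ReIm.
      rewrite e1; apply: cvgM; first exact: cvg_fst.
      by apply: (cvg_comp _ _ (@cvg_snd _ _ _ _ _)); exact: continuous_cos.
    rewrite e2; apply: cvgM; first exact: cvg_fst.
    by apply: (cvg_comp _ _ (@cvg_snd _ _ _ _ _)); exact: continuous_sin.
  have /cvg_normcP/(_ _ d0) := hP.
  by apply: filterS => q; rewrite normc_sub => /hd; rewrite /= distrC.
rewrite inE => Ap hp; exists (P p); split; first exact: nP.
move=> z zr; have [t [t2 ->]] := polar_form z.
apply: (hp (normc z, t)); rewrite inE; split => /=; rewrite in_itv//=.
by rewrite normc_nneg.
Qed.

Lemma jet_continuous_normc f z0 (e : R) : jet 1 f z0 ->
  continuous_at_pt (fun z => normc (f z) + e * normc z ^+ 2) z0.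
Proof.
move=> fj eps eps0; have e2 : 0 < eps / 2 by rewrite divr_gt0.
have [d [d0 hd]] := jet_continuous fj e2.
have j2 : jet 1 (fun z => e%:C * (z * z)) z0.
  by apply: jetM; [exact: jet_cst|apply: jetM; exact: jet_id].
have [d' [d'0 hd']] := jet_continuous j2 e2.
have dist z w : `|normc z - normc w| <= normc (z - w).
  by rewrite ler_norml normc_triangle_sub andbT lerNl opprB normc_sub normc_triangle_sub.
exists (Num.min d d'); split; first by rewrite lt_min d0.
move=> z; rewrite lt_min => /andP[zd zd'].
rewrite opprD addrACA (le_lt_trans (ler_normD _ _))// (splitr eps) ltrD//.
  by rewrite (le_lt_trans (dist _ _))// hd.
rewrite -mulrBr normrM (le_lt_trans _ (hd' _ zd'))// -mulrBr Normc.normcM normc_real.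
by rewrite ler_wpM2l// -!expr2 -!normc_exp dist.
Qed.

Lemma smooth_bounded f r : 0 <= r -> (forall z, normc z <= r -> jet 1 f z) ->
  exists M, forall z, normc z <= r -> normc (f z) <= M.
Proof.
move=> r0 fj.
have [z0 [_ h]] := closed_disk_max r0 (fun z zr => jet_continuous_normc 0 (fj _ zr)).
exists (normc (f z0)) => z /h; rewrite /= !mul0r !addr0//.
Qed.

(* At an interior maximum z0 of |f| + e |z|^2, averaging over z0 +- rho and
   z0 +- i rho cancels the first and second order terms of f, but not the
   term e rho^2. *)
Lemma max_principle f r (B : R) : 0 <= r -> (forall z, normc z <= r -> jet 3 f z) ->
  (forall z, normc z = r -> normc (f z) <= B) ->
  forall z, normc z <= r -> normc (f z) <= B.
Proof.
move=> r0 fj fB z zr; apply/ler_addgt0Pl => eps eps0.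
(* Chosen so that the perturbation e |z|^2 costs at most eps on the closed disk. *)
pose e := eps / (r ^+ 2 + 1).
have r1 : 0 < r ^+ 2 + 1 by rewrite ltr_wpDl ?sqr_ge0.
have e0 : 0 < e by rewrite divr_gt0.
have [z0 [z0r h]] := closed_disk_max r0
  (fun z zr => jet_continuous_normc e (jet_le (isT : (1 <= 3)%N) (fj _ zr))).
suff z0B : normc z0 = r.
  apply: (@le_trans _ _ (normc (f z) + e * normc z ^+ 2)).
    by rewrite lerDl mulr_ge0 ?exprn_ge0 ?normc_nneg// ltW.
  rewrite (le_trans (h _ zr))// addrC lerD ?fB// z0B /e.
  by rewrite mulrAC ler_pdivrMr// ler_wpM2l ?(ltW eps0)// lerDl.
apply/eqP; rewrite eq_le z0r/= leNgt; apply/negP => z0lt.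
have [g1 [[g2 [[g3 [[M [d0 [d00 gM]]] [d3 [d30 E3]]]] [d2 [d20 E2]]]]
  [d1 [d10 E1]]]] := fj _ z0r.
have M0 : 0 <= M by rewrite (le_trans _ (gM z0 _)) ?normc_nneg ?normc_subrr.
pose rho := Num.min (Num.min d0 d1) (Num.min (Num.min d2 d3)
  (Num.min (r - normc z0) (e / (M + 1)))) / 2.
have M1 : 0 < M + 1 by rewrite ltr_wpDl.
have rho2 : 0 < rho * 2.
  by rewrite divfK// !lt_min d00 d10 d20 d30 subr_gt0 z0lt divr_gt0.
have rho0 : 0 < rho by rewrite -(pmulr_lgt0 _ (ltr0Sn R 1)).
have : rho < rho * 2 by rewrite mulr_natr mulr2n ltrDl.
rewrite {2}/rho divfK// !lt_min => /andP[/andP[l0 l1]] /andP[/andP[l2 l3]] /andP[l4 l5].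
have exph w : normc w = rho -> f (z0 + w) =
    f z0 + w * g1 z0 + w ^+ 2 * g2 z0 + w ^+ 3 * g3 (z0 + w) /\
    normc (g3 (z0 + w)) <= M /\
    normc (f (z0 + w)) + e * normc (z0 + w) ^+ 2 <= normc (f z0) + e * normc z0 ^+ 2.
  move=> wr; have zw : z0 + w - z0 = w by ring.
  split; last split.
  - rewrite E1 ?zw ?wr// (E2 (z0 + w)) ?zw ?wr// (E3 (z0 + w)) ?zw ?wr//; ring.
  - by rewrite gM// zw wr.
  - by apply: h; rewrite (le_trans (normc_triangle _ _))// wr; lra.
have rr : normc rho%:C = rho by rewrite normc_real gtr0_norm.
have ni : normc ('i%C : R[i]) = 1.
  by apply/eqP; rewrite -sqrp_eq1 ?normc_nneg// normc_sqr expr0n expr1n add0r.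
have [x1 [y1 u1]] := exph rho%:C rr.
have [x2 [y2 u2]] := exph (- rho%:C) ltac:(by rewrite normc_opp).
have [x3 [y3 u3]] := exph ('i%C * rho%:C) ltac:(by rewrite Normc.normcM ni mul1r).
have [x4 [y4 u4]] := exph (- ('i%C * rho%:C)) ltac:(by rewrite normc_opp Normc.normcM ni mul1r).
have ii : ('i%C : R[i]) ^+ 2 = -1 by rewrite sqr_i.
have sumf : 4 * f z0 = f (z0 + rho%:C) + f (z0 + - rho%:C) + f (z0 + 'i%C * rho%:C)
    + f (z0 + - ('i%C * rho%:C)) - rho%:C ^+ 3 * (g3 (z0 + rho%:C) - g3 (z0 - rho%:C)
     - 'i%C * g3 (z0 + 'i%C * rho%:C) + 'i%C * g3 (z0 - 'i%C * rho%:C)).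
  rewrite {1}x1 {1}x2 {1}x3 {1}x4.
  set a1 := g3 _; set a2 := g3 _; set a3 := g3 _; set a4 := g3 _.
  rewrite (_ : ('i%C * rho%:C) ^+ 2 = - rho%:C ^+ 2); last by rewrite exprMn ii mulN1r.
  rewrite (_ : ('i%C * rho%:C) ^+ 3 = - 'i%C * rho%:C ^+ 3); last first.
    by rewrite exprMn exprS ii mulrN1.
  rewrite (_ : (- ('i%C * rho%:C)) ^+ 2 = - rho%:C ^+ 2); last by rewrite sqrrN exprMn ii mulN1r.
  rewrite (_ : (- ('i%C * rho%:C)) ^+ 3 = 'i%C * rho%:C ^+ 3); last first.
    by rewrite exprNn exprMn (exprS 'i%C) ii; ring.
  ring.
have {sumf} sumn : 4 * normc (f z0) <= normc (f (z0 + rho%:C)) + normc (f (z0 + - rho%:C))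
   + normc (f (z0 + 'i%C * rho%:C)) + normc (f (z0 + - ('i%C * rho%:C))) + rho ^+ 3 * (4 * M).
  have -> : 4 * normc (f z0) = normc (4 * f z0).
    rewrite Normc.normcM (_ : 4 = (4 : R)%:C :> R[i]) ?normc_real ?ger0_norm//.
    by rewrite rmorph_nat.
  rewrite {1}sumf; rewrite (le_trans (normc_triangleB _ _))// lerD//.
    by rewrite !(le_trans (normc_triangle _ _))// lerD// (le_trans (normc_triangle _ _))// lerD// normc_triangle.
  rewrite Normc.normcM normc_exp rr ler_wpM2l ?exprn_ge0 ?(ltW rho0)//.
  have -> : 4 * M = M + M + M + M by ring.
  rewrite (le_trans (normc_triangle _ _))// lerD ?Normc.normcM ?ni ?mul1r//.
  rewrite (le_trans (normc_triangleB _ _))// lerD ?Normc.normcM ?ni ?mul1r//.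
  by rewrite (le_trans (normc_triangleB _ _))// lerD.
have sq : normc (z0 + rho%:C) ^+ 2 + normc (z0 + - rho%:C) ^+ 2
   + normc (z0 + 'i%C * rho%:C) ^+ 2 + normc (z0 + - ('i%C * rho%:C)) ^+ 2 =
   4 * normc z0 ^+ 2 + 4 * rho ^+ 2.
  case: (z0) => a b.
  have -> : 'i%C * rho%:C = 0 +i* rho by simpc.
  by simpc; rewrite !normc_sqr; ring.
(* The four maximality inequalities and the cubic remainder force e <= M rho, against rho < e / (M +
   1). *)
have : e * (4 * rho ^+ 2) <= rho ^+ 3 * (4 * M).
  move: sumn u1 u2 u3 u4 sq; clear; 
  set p1 := normc (f (z0 + rho%:C)); set p2 := normc (f (z0 + - rho%:C)).
  set p3 := normc (f (z0 + 'i%C * rho%:C)); set p4 := normc (f (z0 + - ('i%C * rho%:C))).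
  set p5 := normc (f z0).
  move: p1 p2 p3 p4 p5 => p1 p2 p3 p4 p5 sumn u1 u2 u3 u4 sq.
  have : e * (4 * normc z0 ^+ 2 + 4 * rho ^+ 2) <= rho ^+ 3 * (4 * M) + e * (4 * normc z0 ^+ 2).
    rewrite -sq !mulrDr; lra.
  by rewrite mulrDr; lra.
rewrite leNgt => /negP; apply.
have -> : rho ^+ 3 * (4 * M) = (rho * M) * (4 * rho ^+ 2) by ring.
have r20 : 0 < 4 * rho ^+ 2 by rewrite mulr_gt0// exprn_gt0.
rewrite ltr_pM2r//.
rewrite (@le_lt_trans _ _ (rho * (M + 1)))//; first by rewrite ler_wpM2l ?(ltW rho0)// lerDl.
by rewrite -ltr_pdivlMr.
Qed.

Lemma derive1_eq_slope f g z0 (d : R) : 0 < d -> jet 1 g z0 ->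
  (forall z, normc (z - z0) < d -> f z = f z0 + (z - z0) * g z) ->
  derive1 f z0 = g z0.
Proof.
move=> d0 gj fg; apply: cvg_lim; first exact: norm_hausdorff.
apply/cvg_normcP => e e0.
have [d' [d'0 hg]] := jet_continuous gj e0.
have m0 : (0 : R[i]) < (Num.min d d')%:C by rewrite ltcR lt_min d0.
near=> h.
have h0 : h != 0 by near: h; exact: nbhs_dnbhs_neq.
have hd : normc h < Num.min d d'.
  rewrite -ltcR; near: h; apply: dnbhs0_lt => //.
move: hd; rewrite lt_min => /andP[h1 h2].
rewrite /GRing.scale/= fg; last by rewrite addrK.
rewrite (_ : h^-1 * _ = g (h + z0)); last by rewrite addrK; field.
by rewrite normc_sub hg// addrK.
Unshelve. all: end_near.
Qed.

(** The value at 0 is the one that removes the singularity; [smooth_quot] depends on it. *)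
Definition quot f z : R[i] := if z == 0 then derive1 f 0 else (f z - f 0) / z.

Lemma quotE f z : f z = f 0 + z * quot f z.
Proof.
rewrite /quot; case: eqP => [->|/eqP z0]; first by rewrite mul0r addr0.
by field.
Qed.

Lemma quot_neq0 f z : z != 0 -> quot f z = (f z - f 0) / z.
Proof. by rewrite /quot => /negbTE->. Qed.

Definition smooth_on_disk f := forall z, disk z -> smooth f z.

Lemma smooth_quot f : smooth_on_disk f -> smooth_on_disk (quot f).
Proof.
move=> fs z zd n.
have [->|z0] := eqVneq z 0.
  (* Order n + 2 leaves [g] with order at least 1, and this continuity at 0 identifies [derive1 f 0]
     with [g 0]. *)
  have [|g [gj [d [d0 fg]]]] := fs 0 _ n.+2.
    by rewrite /disk/= Normc.normc0.
  apply: (@jet_local _ _ g _ _ d) => //; last exact: jetW.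
  move=> w wd; rewrite /quot; case: eqP => [->|/eqP w0].
    by rewrite (derive1_eq_slope d0 (@jet_le _ 1 n.+1 _ _ isT gj) fg).
  by rewrite (fg w wd) subr0; field.
have nz : 0 < normc z by rewrite normc_gt0.
apply: (@jet_local _ _ (fun w => (f w - f 0) * w^-1) _ _ (normc z)) => //.
  move=> w; rewrite /quot; case: eqP => [->|//].
  by rewrite sub0r normc_opp ltxx.
apply: jetM; last exact: jet_inv.
by apply: jetB; [exact: fs|exact: jet_cst].
Qed.

Lemma smooth_iter_quot f n : smooth_on_disk f -> smooth_on_disk (iter n (@quot) f).
Proof. by move=> fs; elim: n => //= n; exact: smooth_quot. Qed.

(** This is the n-th Taylor coefficient, free of factorials and higher derivatives, so that any
    estimate stable under [quot] bounds all coefficients. *)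
Definition taylor f n : R[i] := iter n quot f 0.

Lemma taylor_remainder f n z :
  f z = \sum_(i < n) taylor f i * z ^+ i + z ^+ n * iter n quot f z.
Proof.
elim: n => [|n IH]; first by rewrite big_ord0 expr0 add0r mul1r.
rewrite big_ord_recr/= {1}IH -addrA; congr (_ + _).
by rewrite {1}[iter n quot f z]quotE exprSr /taylor; ring.
Qed.

Lemma disk_le r z : r < 1 -> normc z <= r -> disk z.
Proof. by move=> r1 /le_lt_trans; exact. Qed.

(** On |z| = r a quotient is at most (|g(z)| + |g(0)|) / r, which costs a factor 2 / r; the maximum
    principle carries the bound inside, across the point 0 where the division is impossible. *)
Lemma iter_quot_bound f r M n : 0 < r < 1 -> smooth_on_disk f ->
  (forall z, normc z <= r -> normc (f z) <= M) ->
  forall z, normc z <= r -> normc (iter n quot f z) <= M * (2 / r) ^+ n.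
Proof.
move=> /andP[r0 r1] fs fM; elim: n => [|n IH] z zr; first by rewrite expr0 mulr1 fM.
have gs := smooth_iter_quot n fs.
apply: max_principle zr; [exact: ltW| |].
  by move=> w /(disk_le r1)/(smooth_quot gs); exact.
move=> w wr /=.
have w0 : w != 0 by rewrite -normc_gt0 wr.
rewrite quot_neq0// Normc.normcM Normc.normcV wr.
have -> : M * (2 / r) ^+ n.+1 = (M * (2 / r) ^+ n + M * (2 / r) ^+ n) / r.
  by rewrite exprSr; field; rewrite gt_eqF.
rewrite ler_wpM2r ?invr_ge0 ?(ltW r0)// (le_trans (normc_triangleB _ _))// lerD ?IH ?wr//.
by rewrite Normc.normc0 ltW.
Qed.

(** With r = 1/2 the remainder quotients grow at most like 4^n, whence the radius 1/4. *)
Lemma taylor_series f z : smooth_on_disk f -> normc z < 4^-1 ->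
  series (fun n => taylor f n * z ^+ n) @ \oo --> f z.
Proof.
move=> fs z4.
have r1 : (2^-1 : R) < 1 by lra.
have [|M hM] := @smooth_bounded f 2^-1 _ (fun w wr => fs _ (disk_le r1 wr) 1%N); first by lra.
apply/cvgn_normcP => e e0.
have q4 : `|normc z * 4| < 1 by rewrite ger0_norm ?mulr_ge0 ?normc_nneg//; lra.
have /cvgrPdist_lt/(_ _ e0)[N _ hN] := cvg_geometric M q4.
exists N => n /hN /=; rewrite sub0r normrN /series/= big_mkord => h.
rewrite {1}(taylor_remainder f n z) addrAC subrr add0r Normc.normcM normc_exp.
rewrite (le_lt_trans _ (le_lt_trans (ler_norm _) h))// exprMn mulrCA ler_wpM2l//.
  by rewrite exprn_ge0// normc_nneg.
have := @iter_quot_bound f 2^-1 M n _ fs hM z; rewrite invrK -natrM; apply; last by lra.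
by apply/andP; split; lra.
Qed.

Lemma smooth_analytic f : smooth_on_disk f -> analytic_on_disk f.
Proof.
move=> fs z0 z0d; pose rho := 1 - normc z0.
have rho0 : 0 < rho by rewrite subr_gt0.
have rhoC : rho%:C != 0 by rewrite (inj_eq (@complexI R)) gt_eqF.
(* The disk of radius 1 - |z0| about z0 is rescaled to the unit disk, where the expansion at 0 is
   available. *)
pose F z := f (z0 + rho%:C * z).
have Fs : smooth_on_disk F.
  move=> z zd n; apply: (@jet_comp _ n f (fun z => z0 + rho%:C * z)).
    apply: fs; rewrite /disk/= (le_lt_trans (normc_triangle _ _))//.
    rewrite Normc.normcM normc_real gtr0_norm// -ltrBrDl -/rho.
    by rewrite gtr_pMr.
  by apply: jetD; [exact: jet_cst|apply: jetM; [exact: jet_cst|exact: jet_id]].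
exists (fun n => taylor F n / rho%:C ^+ n), (rho / 4); split; first by rewrite divr_gt0.
move=> z zr.
have : normc ((z - z0) / rho%:C) < 4^-1.
  by rewrite Normc.normcM Normc.normcV normc_real gtr0_norm// ltr_pdivrMr// mulrC.
move=> /(taylor_series Fs); rewrite [F _](_ : _ = f z); last first.
  by rewrite /F; congr f; field.
rewrite (_ : (fun n => _) = (fun n => taylor F n / rho%:C ^+ n * (z - z0) ^+ n))//.
by apply/funext => n; rewrite expr_div_n mulrA mulrAC.
Qed.

Lemma analytic_smooth f : analytic_on_disk f -> smooth_on_disk f.
Proof. by move=> fa z /fa [a [r [r0 h]]] n; exact: jet_pseries_center r0 h. Qed.

End max_principle.

(** * The mean value inequality for the square root of the modulus *)

Section submean.
Variable R : realType.
Implicit Types (f g : R[i] -> R[i]) (z : R[i]) (r s t w : R).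

Lemma segment_uniform_continuity (G : R -> R) (a b e : R) : continuous G -> 0 < e ->
  exists d : R, 0 < d /\
    forall x y, a <= x <= b -> `|y - x| < d -> `|G y - G x| < e.
Proof.
move=> Gc e0.
have /compact_near_coveringP/(_ R (0^'+)%R
  (fun d x => forall y, `|y - x| < d -> `|G y - G x| < e) _) := @segment_compact R a b.
have H x : `[a, b]%classic x -> \forall x' \near x & d \near (0^'+)%R,
   forall y, `|y - x'| < d -> `|G y - G x'| < e.
  move=> _; have e2 : 0 < e / 2 by rewrite divr_gt0.
  have /cvgrPdist_lt/(_ _ e2)/nbhs_ballP[d /= d0 hd] := Gc x.
  have d2 : 0 < d / 2 by rewrite divr_gt0.
  exists (ball x (d / 2), [set d' | d' < d / 2]) => /=.
    by split; [exact: nbhsx_ballx|exact: nbhs_right_lt].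
  move=> [x' d'] /= [xx' dd'] y yx.
  have h1 : `|G x - G x'| < e / 2.
    by apply: hd; rewrite /ball/= (lt_trans xx')//; lra.
  have h2 : `|G x - G y| < e / 2.
    apply: hd; rewrite /ball/= (_ : x - y = (x - x') - (y - x')); last by ring.
    rewrite (le_lt_trans (ler_normB _ _))// (splitr d) ltrD//.
    exact: lt_trans dd'.
  rewrite (_ : G y - G x' = (G x - G x') - (G x - G y)); last by ring.
  by rewrite (le_lt_trans (ler_normB _ _))// (splitr e) ltrD.
move=> /(_ H) near_d.
have [d [d0 hd]] : exists d : R, 0 < d /\ (`[a, b]%classic `<=`
    (fun x => forall y, `|y - x| < d -> `|G y - G x| < e)).
  near (0 : R)^'+ => d; exists d; split; first by [].
  by near: d.
by exists d; split => // x y xab; apply: hd; rewrite /= in_itv.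
Unshelve. all: end_near.
Qed.

Lemma step_integral_le (G : R -> R) (w : R) (c : nat -> R) n : 0 < w ->
  continuous G -> (forall t, 0 <= G t) -> (forall k, 0 <= c k) ->
  (forall t k, (k < n)%N -> k%:R * w <= t < k.+1%:R * w -> c k <= G t) ->
  ((w * \sum_(k < n) c k)%:E <=
   \int[lebesgue_measure]_(t in `[0%R, (n%:R * w)%R[) (G t)%:E)%E.
Proof.
move=> w0 Gc G0 c0 cG.
have mG (D : set R) : measurable_fun D (fun t => (G t)%:E).
  by apply/measurable_EFinP; apply: measurable_funTS; exact: continuous_measurable_fun.
elim: n cG => [|n IH] cG.
  by rewrite big_ord0 mulr0 mul0r set_itvco0 integral_set0.
have nw : (n%:R : R) * w < n.+1%:R * w by rewrite ltr_pM2r// ltr_nat.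
have n0 : 0 <= (n%:R : R) * w by rewrite mulr_ge0// ltW.
rewrite (@itv_bndbnd_setU _ _ _ (BLeft (n%:R * w)))//; last by rewrite bnd_simp ltW.
rewrite ge0_integral_setU//=; last 3 first.
  - exact: mG.
  - by move=> t _; rewrite lee_fin.
  - apply/disj_setPS => t [] /=; rewrite !in_itv/= => /andP[_ t1] /andP[t2 _].
    by move: t1; rewrite ltNge t2.
rewrite big_ord_recr/= mulrDr EFinD leeD//.
  by apply: IH => t k kn; apply: cG; exact: ltnW.
have -> : (w * c n)%:E = (\int[lebesgue_measure]_(t in `[(n%:R * w)%R, (n.+1%:R * w)%R[) (cst (c n)%:E t))%E.
  rewrite integral_cst//= lebesgue_measure_itv/= lte_fin nw -EFinB -EFinM.
  by congr EFin; rewrite -[n.+1]addn1 natrD; ring.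
apply: ge0_le_integral => //.
- by move=> t _; rewrite lee_fin.
- exact: mG.
by move=> t; rewrite /= in_itv/= => tn; rewrite lee_fin; exact: cG.
Qed.

(** The hypothesis bounds Riemann sums whose offset t may vary with n. Once the mesh is below the
    modulus of uniform continuity for e, every sample is within e of G on its whole cell, wherever
    the offset lies. *)
Lemma riemann_integral_ge (G : R -> R) (c : R) : continuous G -> (forall t, 0 <= G t) ->
  (forall n, exists t, 0 <= t <= 2 * pi / n.+1%:R /\
    c <= (\sum_(k < n.+1) G (t + k%:R * (2 * pi / n.+1%:R))) / n.+1%:R) ->
  (c%:E <= (2 * pi)^-1%:E * \int[lebesgue_measure]_(t in @angles R) (G t)%:E)%E.
Proof.
move=> Gc G0 h; apply/lee_addgt0Pr => e e0.
have pi2 : 0 < 2 * pi :> R by rewrite mulr_gt0// pi_gt0.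
have [d [d0 hd]] := segment_uniform_continuity 0 (2 * pi) Gc e0.
pose n := Num.truncn (2 * pi / d).
have nd : 2 * pi / n.+1%:R < d.
  have /andP[_] : n%:R <= 2 * pi / d < n.+1%:R by apply: truncn_itv; rewrite divr_ge0// ltW.
  by rewrite !ltr_pdivrMr// [d * _]mulrC.
set w := 2 * pi / n.+1%:R in nd.
have w0 : 0 < w by rewrite divr_gt0.
have [t [/andP[t0 tw]]] := h n; rewrite -/w in tw * => tc.
(* The truncation at 0 keeps the step function nonnegative, as [step_integral_le] requires, and
   stays below G because G is nonnegative. *)
pose cc k := Num.max 0 (G (t + k%:R * w) - e).
have mG (D : set R) : measurable_fun D (fun t => (G t)%:E).
  by apply/measurable_EFinP; apply: measurable_funTS; exact: continuous_measurable_fun.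
have nw : n.+1%:R * w = 2 * pi by rewrite /w mulrC divfK.
have kw k : (k < n.+1)%N -> (k.+1%:R : R) * w <= 2 * pi by move=> kn; rewrite -nw ler_pM2r// ler_nat.
have hcc s k : (k < n.+1)%N -> k%:R * w <= s < k.+1%:R * w -> cc k <= G s.
  move=> kn /andP[s1 s2]; rewrite /cc ge_max G0/= lerBlDr -lerBlDl.
  have k0 : 0 <= k%:R * w by rewrite mulr_ge0// ltW.
  have := kw _ kn; rewrite -[in k.+1%:R]addn1 natrD mulrDl mul1r => h1.
  move: s2; rewrite -[in k.+1%:R]addn1 natrD mulrDl mul1r => s2.
  rewrite (le_trans (ler_norm _))// distrC; apply/ltW/hd.
    by apply/andP; split; lra.
  apply: le_lt_trans nd; rewrite ler_norml; apply/andP; split; lra.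
have := @step_integral_le G w cc n.+1 w0 Gc G0 _ hcc.
rewrite nw => I1.
have {}I1 : ((w * \sum_(k < n.+1) cc k)%:E <= \int[lebesgue_measure]_(t in @angles R) (G t)%:E)%E.
  apply: (@le_trans _ _ (\int[lebesgue_measure]_(t in `[0%R, (2 * pi)%R[) (G t)%:E)%E).
    by apply: I1 => k; rewrite /cc le_max lexx.
  apply: ge0_subset_integral => //.
  - exact: measurable_itv.
  - exact: mG.
  - by move=> ? _; rewrite lee_fin.
  by move=> x; rewrite /angles/= !in_itv/= => /andP[-> /ltW].
apply: (@le_trans _ _ (((2 * pi)^-1 * (w * \sum_(k < n.+1) cc k))%:E + e%:E)%E); last first.
  by rewrite leeD2r// EFinM lee_wpmul2l// lee_fin invr_ge0 ltW.
rewrite -EFinD lee_fin (le_trans tc)//.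
have -> : (2 * pi)^-1 * (w * \sum_(k < n.+1) cc k) = (\sum_(k < n.+1) cc k) / n.+1%:R.
  by rewrite /w; move: (2 * pi) pi2 => p p0; rewrite !mulrA mulVf ?gt_eqF// mul1r mulrC.
have -> : e = (\sum_(k < n.+1) e) / n.+1%:R.
  by rewrite sumr_const card_ord -[e *+ _]mulr_natr mulfK// pnatr_eq0.
rewrite -mulrDl -big_split/= ler_wpM2r// ler_sum// => k _.
by rewrite -lerBlDr /cc le_max lexx orbT.
Qed.

Lemma smooth_circle_continuous f r : 0 <= r < 1 -> smooth_on_disk f ->
  continuous (fun t => normc (f (r%:C * expi t))).
Proof.
move=> /andP[r0 r1] fs t; apply/cvgrPdist_lt => e e0.
have zd : disk (r%:C * expi t) by rewrite /disk/= normc_polar.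
have [d [d0 hd]] := jet_continuous_normc 0 (fs _ zd 1%N) e0.
apply: filterS (expi_continuous t d0) => s h.
have := hd (r%:C * expi s); rewrite !mul0r !addr0 distrC; apply.
rewrite -mulrBr Normc.normcM normc_real ger0_norm//.
by rewrite (le_lt_trans _ h)// ler_piMl ?normc_nneg// ltW.
Qed.

Lemma jet_prod f (c : nat -> R[i]) n m z0 : smooth_on_disk f ->
  (forall k, normc (c k) = 1) -> disk z0 ->
  jet m (fun z => \prod_(k < n) f (c k * z)) z0.
Proof.
move=> fs c1 zd; elim: n => [|n IH].
  apply: (@jet_local _ _ (fun=> 1) _ _ 1) => //; last exact: jet_cst.
  by move=> z _; rewrite big_ord0.
apply: (@jet_local _ _ (fun z => (\prod_(k < n) f (c k * z)) * f (c n * z)) _ _ 1) => //.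
  by move=> z _; rewrite big_ord_recr.
apply: jetM => //; apply: (@jet_comp _ m f (fun z => c n * z)).
  by apply: fs; rewrite /disk/= Normc.normcM c1 mul1r.
by apply: jetM; [exact: jet_cst|exact: jet_id].
Qed.

(* The product F of the rotates of f satisfies F 0 = (f 0)^(n+1), and every
   point of the circle is a rotate of a point of the arc [0, w]. *)
Lemma rotation_product_max f r n : 0 < r < 1 -> smooth_on_disk f ->
  let w := 2 * pi / n.+1%:R in
  exists t, 0 <= t <= w /\
    normc (f 0) ^+ n.+1 <= \prod_(k < n.+1) normc (f (r%:C * expi (t + k%:R * w))).
Proof.
move=> /andP[r0 r1] fs w.
have pi2 : 0 < 2 * pi :> R by rewrite mulr_gt0// pi_gt0.
have w0 : 0 < w by rewrite divr_gt0.
pose c (k : nat) : R[i] := expi (k%:R * w).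
have c1 k : normc (c k) = 1 by exact: expi_norm.
pose F z := \prod_(k < n.+1) f (c k * z).
have Fs : smooth_on_disk F by move=> z zd m; exact: jet_prod.
have cn : c n.+1 = 1 by rewrite /c /w mulrC divfK// expi2pi.
have cS k : c k.+1 = c k * c 1%N.
  by rewrite /c -expiD -[k.+1]addn1 natrD mulrDl.
(* The rotation permutes the factors cyclically, the last one returning to the first since
   [c n.+1 = 1]. *)
have Frot z : F (c 1%N * z) = F z.
  rewrite /F big_ord_recr big_ord_recl/= !mulrA -!cS cn.
  rewrite (_ : c 0%N = 1); last by rewrite /c mul0r expi0.
  rewrite mulrC; congr (_ * _); apply: eq_bigr => k _.
  by rewrite mulrA -cS.
have FrotJ j z : F (c j * z) = F z.
  elim: j => [|j IH]; first by rewrite /c mul0r expi0 mul1r.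
  by rewrite cS -(mulrC (c 1%N)) -mulrA Frot.
have Fc := @smooth_circle_continuous F r (introT andP (conj (ltW r0) r1)) Fs.
have [t tw tmax] := @EVT_max R _ 0 w (ltW w0) (continuous_subspaceT Fc).
exists t; split; first by move: tw; rewrite in_itv.
have F0 : normc (F 0) = normc (f 0) ^+ n.+1.
  rewrite /F normc_prod (eq_bigr (fun=> normc (f 0))) => [|k _]; last by rewrite mulr0.
  by rewrite prodr_const card_ord.
rewrite -F0 (_ : \prod_(_ < _) _ = normc (F (r%:C * expi t))); last first.
  rewrite /F normc_prod; apply: eq_bigr => k _; congr (normc (f _)).
  by rewrite /c addrC expiD; ring.
apply: (@max_principle _ F r _ (ltW r0)) => [z zr|z zr|].
- exact/Fs/(disk_le r1 zr).
- have [s [/andP[s0 s2]]] := polar_form z; rewrite zr => ->.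
  pose j := Num.truncn (s / w).
  have /andP[j1 j2] : j%:R <= s / w < j.+1%:R by apply: truncn_itv; rewrite divr_ge0// ltW.
  have -> : r%:C * expi s = c j * (r%:C * expi (s - j%:R * w)).
    by rewrite mulrCA /c -expiD addrC subrK.
  rewrite FrotJ; apply: tmax; rewrite in_itv/= subr_ge0 -ler_pdivlMr// j1/=.
  by move: j2; rewrite ltr_pdivrMr// -[j.+1]addn1 natrD mulrDl mul1r => j2; lra.
- by rewrite Normc.normc0 ltW.
Qed.

(** AM-GM for the numbers sqrt(a_i). With a_i the moduli at the rotated points, it turns the product
    inequality into a Riemann sum of sqrt|f|. *)
Lemma AGM_sqrt n (a : 'I_n.+1 -> R) (b : R) : 0 <= b -> (forall i, 0 <= a i) ->
  b ^+ n.+1 <= \prod_i a i -> Num.sqrt b <= (\sum_i Num.sqrt (a i)) / n.+1%:R.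
Proof.
move=> b0 a0 h.
have S0 : 0 <= (\sum_i Num.sqrt (a i)) / n.+1%:R.
  by rewrite divr_ge0// sumr_ge0// => i _; rewrite sqrtr_ge0.
rewrite -(ler_pXn2r (n := n.+1))// ?nnegrE ?sqrtr_ge0//.
have := (@leif_AGM R _ [pred i : 'I_n.+1 | true] (fun i => Num.sqrt (a i))
  (fun i _ => sqrtr_ge0 _)).1.
rewrite card_ord /= => H; apply: le_trans (H : \prod_i Num.sqrt (a i) <= _).
have sqp (s : seq 'I_n.+1) : \prod_(i <- s) Num.sqrt (a i) = Num.sqrt (\prod_(i <- s) a i).
  elim: s => [|x s IH]; first by rewrite !big_nil sqrtr1.
  by rewrite !big_cons IH sqrtrM.
rewrite sqp -(_ : Num.sqrt (b ^+ n.+1) = Num.sqrt b ^+ n.+1); last first.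
  by elim: (n.+1) => [|m IH]; rewrite ?expr0 ?sqrtr1// !exprS sqrtrM// IH.
by rewrite ler_sqrt// prodr_ge0.
Qed.

Lemma submean_sqrt f r : 0 < r < 1 -> smooth_on_disk f ->
  ((Num.sqrt (normc (f 0)))%:E <=
    circle_integral (fun z => (Num.sqrt (normc (f (r%:C * z))))%:E))%E.
Proof.
move=> r01 fs; have /andP[r0 r1] := r01.
apply: (@riemann_integral_ge (fun t => Num.sqrt (normc (f (r%:C * expi t))))).
- move=> t; apply: (@continuous_comp _ _ _ (fun t => normc (f (r%:C * expi t))) Num.sqrt).
    by apply: smooth_circle_continuous => //; rewrite r1 ltW.
  exact: sqrt_continuous.
- by move=> t; exact: sqrtr_ge0.
move=> n; have [t [tw h]] := rotation_product_max n r01 fs.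
by exists t; split => //; apply: AGM_sqrt h => // *; exact: normc_nneg.
Qed.

End submean.

(** * Taylor coefficients on the unit ball of the Hardy-Orlicz space *)

Section unit_ball.
Variable R : realType.
Implicit Types (f g : R[i] -> R[i]) (z : R[i]) (r s t K : R).
Local Notation mu := (@lebesgue_measure R).
Local Notation arc := (@angles R).

Let pi2 : 0 < 2 * pi :> R. Proof. by rewrite mulr_gt0// pi_gt0. Qed.

Lemma measurable_angles : measurable arc.
Proof. exact: measurable_itv. Qed.

Lemma angles_measure : mu arc = (2 * pi)%:E.
Proof. by rewrite /angles lebesgue_measure_itv/= lte_fin pi2 sube0. Qed.

Definition circle_mean (h : R -> R) : \bar R :=
  ((2 * pi)^-1%:E * \int[mu]_(t in arc) (h t)%:E)%E.

Lemma circle_meanE (G : R[i] -> R) :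
  circle_integral (fun z => (G z)%:E) = circle_mean (fun t => G (expi t)).
Proof. by []. Qed.

Lemma circle_mean_le (h1 h2 : R -> R) :
  (forall t, 0 <= h1 t) -> measurable_fun arc h1 -> measurable_fun arc h2 ->
  (forall t, arc t -> h1 t <= h2 t) -> (circle_mean h1 <= circle_mean h2)%E.
Proof.
move=> h0 m1 m2 h12; rewrite lee_wpmul2l// ?lee_fin ?invr_ge0 ?(ltW pi2)//.
apply: ge0_le_integral => //.
- exact: measurable_angles.
- by move=> t _; rewrite lee_fin.
- exact/measurable_EFinP.
- exact/measurable_EFinP.
Qed.

Lemma circle_meanD (h1 h2 : R -> R) :
  (forall t, 0 <= h1 t) -> measurable_fun arc h1 ->
  (forall t, 0 <= h2 t) -> measurable_fun arc h2 ->
  circle_mean (fun t => h1 t + h2 t) = (circle_mean h1 + circle_mean h2)%E.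
Proof.
move=> h10 m1 h20 m2; rewrite /circle_mean.
under eq_integral do rewrite EFinD.
rewrite ge0_integralD//=.
- rewrite ge0_muleDr//.
  + by apply: integral_ge0 => t _; rewrite lee_fin.
  + by apply: integral_ge0 => t _; rewrite lee_fin.
- exact: measurable_angles.
- by move=> t _; rewrite lee_fin.
- exact/measurable_EFinP.
- by move=> t _; rewrite lee_fin.
- exact/measurable_EFinP.
Qed.

Lemma circle_meanZ K (h : R -> R) : 0 <= K ->
  (forall t, 0 <= h t) -> measurable_fun arc h ->
  circle_mean (fun t => K * h t) = (K%:E * circle_mean h)%E.
Proof.
move=> K0 h0 m; rewrite /circle_mean.
under eq_integral do rewrite EFinM.
rewrite ge0_integralZl_EFin//.
- by rewrite muleCA.
- exact: measurable_angles.
- by move=> t _; rewrite lee_fin.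
- exact/measurable_EFinP.
Qed.

Lemma circle_mean_cst K : circle_mean (cst K) = K%:E.
Proof.
rewrite /circle_mean (_ : (fun t => _) = cst K%:E)// integral_cst; last exact: measurable_angles.
by rewrite -[X in (_ * (_ * X))%E]/(mu arc) angles_measure -!EFinM mulrCA mulVf ?mulr1// gt_eqF.
Qed.

Lemma measurable_continuous (h : R -> R) : continuous h -> measurable_fun arc h.
Proof. by move=> hc; apply: measurable_funTS; exact: continuous_measurable_fun. Qed.

Lemma measurable_normc g : circle_measurable g ->
  measurable_fun arc (fun t => normc (g (expi t))).
Proof.
move=> [mR mI].
have -> : (fun t => normc (g (expi t))) =
  Num.sqrt \o (fun t => complex.Re (g (expi t)) ^+ 2 + complex.Im (g (expi t)) ^+ 2).
  by apply/funext => t /=; rewrite -normc_sqr sqrtr_sqr ger0_norm ?normc_nneg//; case: (g _).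
apply: measurableT_comp; first by apply: continuous_measurable_fun; exact: sqrt_continuous.
by apply: measurable_funD; exact: measurable_funX.
Qed.

Lemma measurable_psi2 g (c : R) : circle_measurable g ->
  measurable_fun arc (fun t => psi2 (normc (g (expi t)) / c)).
Proof.
move=> mg; rewrite /psi2; apply: measurable_funB; last exact: measurable_cst.
apply: measurableT_comp; first exact: measurable_expR.
apply: measurable_funX; apply: measurable_funM; last exact: measurable_cst.
exact: measurable_normc.
Qed.

Lemma psi2_ge_sqr (x : R) : x ^+ 2 <= psi2 x.
Proof. by rewrite /psi2; have := expR_ge1Dx (x ^+ 2); lra. Qed.

Lemma psi2_ge0 (x : R) : 0 <= psi2 x.
Proof. by rewrite (le_trans _ (psi2_ge_sqr x))// sqr_ge0. Qed.

(** With E = exp(x^2 / (n+1)) this is Bernoulli's inequality E^(n+1) - 1 >= (n+1) (E - 1). It shows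
    that enlarging the Luxemburg constant lowers a finite modular to 1. *)
Lemma psi2_div (x : R) n : n.+1%:R * psi2 (x / n.+1%:R) <= psi2 x.
Proof.
rewrite /psi2; set y := x ^+ 2; have y0 : 0 <= y by exact: sqr_ge0.
have n0 : 0 < (n.+1%:R : R) by [].
have h1 : expR ((x / n.+1%:R) ^+ 2) <= expR (y / n.+1%:R).
  rewrite ler_expR expr_div_n ler_wpM2l// lef_pV2 ?posrE ?exprn_gt0//.
  by rewrite expr2 ler_peMl ?(ltW n0)// ler1n.
have h2 : expR y = expR (y / n.+1%:R) ^+ n.+1.
  by rewrite -expRM_natl; congr expR; rewrite mulrC divfK.
have e1 : 1 <= expR (y / n.+1%:R) by rewrite -expR0 ler_expR divr_ge0.
apply: (@le_trans _ _ (n.+1%:R * (expR (y / n.+1%:R) - 1))).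
  by rewrite ler_wpM2l// lerB.
rewrite h2; move: (expR (y / n.+1%:R)) e1 => E E1.
rewrite lerBrDr; elim: n {n0 h1 h2} => [|n IH]; first by rewrite expr1 mul1r; lra.
rewrite exprS; have EE : 1 <= E ^+ n.+1 by rewrite exprn_ege1.
apply: (@le_trans _ _ (E * (n.+1%:R * (E - 1) + 1))); last first.
  by rewrite ler_wpM2l//; lra.
have nn : 0 <= n.+1%:R * (E - 1) * (E - 1) by rewrite !mulr_ge0//; lra.
by rewrite -[n.+2]addn1 natrD; lra.
Qed.

Lemma luxemburg_lt2 g : orlicz psi2 g -> luxemburg_norm psi2 g <= 1 ->
  exists c : R, 0 < c < 2 /\ (orlicz_modular psi2 g c <= 1)%E.
Proof.
move=> [mg [c0 [c00 mc0]]] N1.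
set A := [set c : R | 0 < c /\ (orlicz_modular psi2 g c <= 1)%E].
have Alb : lbound A 0 by move=> c [] /ltW.
(* [inf] of the empty set is 0, so the norm bound gives no admissible constant until the set is
   inhabited. A modular L at c0 becomes at most 1 at c0 (n+1) when n + 1 > L. *)
have Anz : A !=set0.
  pose L := fine (orlicz_modular psi2 g c0); pose n := Num.truncn L.
  have L0 : (0 <= orlicz_modular psi2 g c0)%E.
    rewrite mule_ge0 ?lee_fin ?invr_ge0 ?(ltW pi2)//.
    by apply: integral_ge0 => t _; rewrite lee_fin psi2_ge0.
  have Lfin : orlicz_modular psi2 g c0 = L%:E by rewrite fineK// ge0_fin_numE.
  have /andP[_ Ln] : n%:R <= L < n.+1%:R by apply: truncn_itv; rewrite -lee_fin -Lfin.
  exists (c0 * n.+1%:R); split; first by rewrite mulr_gt0.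
  have : (n.+1%:R%:E * orlicz_modular psi2 g (c0 * n.+1%:R)%R <= n.+1%:R%:E)%E.
    rewrite /orlicz_modular circle_meanE -circle_meanZ//; last 2 first.
    - by move=> t; exact: psi2_ge0.
    - exact: measurable_psi2.
    apply: (@le_trans _ _ (orlicz_modular psi2 g c0)); last by rewrite Lfin lee_fin ltW.
    rewrite /orlicz_modular circle_meanE; apply: circle_mean_le.
    - by move=> t; rewrite mulr_ge0// psi2_ge0.
    - by apply: measurable_funM; [exact: measurable_cst|exact: measurable_psi2].
    - exact: measurable_psi2.
    - by move=> t _; rewrite invfM mulrA; exact: psi2_div.
  by rewrite -{2}[n.+1%:R%:E]mule1 lee_pmul2l// lte_fin.
have [c [c1 mc] cA] := inf_adherent ltr01 (conj Anz (ex_intro _ 0 Alb)).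
exists c; split => //; rewrite c1/= (lt_le_trans cA)//.
by rewrite -[2]/(1 + 1) lerD2r.
Qed.

Lemma measurable_circle_trace f r : 0 <= r < 1 -> smooth_on_disk f ->
  measurable_fun arc (fun t => normc (f (r%:C * expi t))).
Proof.
move=> r01 fs; apply: measurable_continuous.
exact: smooth_circle_continuous r01 fs.
Qed.

(* Dominated convergence applies to min (sqrt |f|) M, and
   sqrt x <= min (sqrt x) M + x / M, where M bounds the means of |f|. *)
Lemma hardy_orlicz_radius f : hardy_orlicz psi2 f -> hardy_orlicz_norm psi2 f <= 1 ->
  exists r, 2^-1 <= r < 1 /\
    (circle_mean (fun t => Num.sqrt (normc (f (r%:C * expi t))))%R <= 7%:E)%E.
Proof.
move=> [[fa [M0 fM0]] fb fo] N1.
have fs := analytic_smooth fa.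
pose M := `|M0| + 1.
have M1 : 0 < M by rewrite ltr_wpDl.
have fM r : 0 <= r < 1 -> (circle_mean (fun t => normc (f (r%:C * expi t)))%R <= M%:E)%E.
  move=> /fM0 h; rewrite (le_trans h)// lee_fin /M (le_trans (ler_norm _))// lerDl//.
have [c [/andP[c0 c2] mc]] := luxemburg_lt2 fo N1.
have [mf _] := fo.
pose T x := Num.min (Num.sqrt x) M.
have Tc : continuous T.
  move=> x; apply: (@continuous_min _ _ Num.sqrt (cst M)); first exact: sqrt_continuous.
  exact: cst_continuous.
have T0 x : 0 <= T x by rewrite /T le_min sqrtr_ge0 ltW.
have TM x : T x <= M by rewrite /T ge_min lexx orbT.
pose rr (j : nat) : R := 1 - j.+2%:R^-1.
have rr1 j : 2^-1 <= rr j < 1.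
  rewrite /rr gtrBl invr_gt0 ltr0n andbT.
  have : (j.+2%:R : R)^-1 <= 2^-1 by rewrite lef_pV2 ?posrE// ler_nat.
  by move: (_^-1) => x; lra.
have rr01 j : 0 <= rr j < 1 by have /andP[h1 ->] := rr1 j; rewrite andbT; lra.
pose h j t := T (normc (f ((rr j)%:C * expi t))).
pose hl t := T (normc (boundary f (expi t))).
have h0 j t : 0 <= h j t by exact: T0.
have hl0 t : 0 <= hl t by exact: T0.
have hM j t : h j t <= M by exact: TM.
have mh j : measurable_fun arc (h j).
  apply: measurableT_comp; first exact: continuous_measurable_fun.
  exact: measurable_circle_trace.
have mhl : measurable_fun arc hl.
  apply: measurableT_comp; first exact: continuous_measurable_fun.
  exact: measurable_normc.
have intM : mu.-integrable arc (cst M%:E).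
  apply/integrableP; split; first exact: measurable_cst.
  rewrite (_ : (fun x => _) = cst M%:E); last by apply/funext => x /=; rewrite gtr0_norm.
  rewrite integral_cst; last exact: measurable_angles.
  by rewrite -[X in (_ * X)%E]/(mu arc) angles_measure -EFinM ltry.
have [|||//||_ _ cvI] := @dominated_convergence _ _ R mu arc measurable_angles
  (fun j t => (h j t)%:E) (fun t => (hl t)%:E) (cst M%:E).
- by move=> j; apply/measurable_EFinP; exact: mh.
- exact/measurable_EFinP.
- apply: negligibleS fb => t /=; apply: contra_not => + at1 => /(_ at1)/cvg_normcP cvf.
  apply: cvg_EFin; first by near=> j.
  suff cx : (fun j => normc (f ((rr j)%:C * expi t))) @ \oo --> normc (boundary f (expi t)).
    exact: (cvg_comp _ _ cx (Tc _)).
  apply/cvgrPdist_lt => e e0; have := cvf _ e0 => -[d /= d0 hd].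
  have /cvgrPdist_lt/(_ _ d0)[N _ hN] := @cvg_harmonic R.
  exists N => // j /= Nj.
  have := hd (rr j); rewrite /ball/= /rr opprB addrCA subrr addr0.
  have := hN j.+1 (leqW Nj); rewrite sub0r normrN /= => /[swap]/[apply].
  rewrite gtrBl invr_gt0 ltr0n => /(_ isT).
  apply: le_lt_trans; rewrite ler_norml normc_triangle_sub andbT.
  by rewrite lerNl opprB normc_sub normc_triangle_sub.
- by apply: aeW => t j _ /=; rewrite lee_fin /h ger0_norm ?T0 ?TM.
(* Here 5 = 1 + 4: sqrt x <= 1 + x^2 <= 1 + 4 (x/c)^2 as c < 2, and [psi2] dominates the square
   while its modular at c is at most 1. *)
have Ihl : (circle_mean hl <= 5%:E)%E.
  apply: (@le_trans _ _ (circle_mean (fun t => 1 + 4 * psi2 (normc (boundary f (expi t)) / c)))).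
    apply: circle_mean_le => //.
      apply: measurable_funD; first exact: measurable_cst.
      by apply: measurable_funM; [exact: measurable_cst|exact: measurable_psi2].
    move=> t _; set x := normc _; have x0 : 0 <= x by exact: normc_nneg.
    rewrite /hl /T ge_min; apply/orP; left.
    have h1 : Num.sqrt x <= 1 + x ^+ 2.
      have s0 := sqrtr_ge0 x; have := sqr_sqrtr x0; set s := Num.sqrt x in s0 *.
      move=> <-; have [s1|s1] := leP s 1; first by rewrite ler_wpDr// sqr_ge0.
      rewrite ler_wpDl// -exprM -[leLHS]expr1 ler_weXn2l// ltW//.
    rewrite (le_trans h1)// lerD2l (@le_trans _ _ (4 * (x / c) ^+ 2))//.
      rewrite expr_div_n mulrCA ler_peMr ?sqr_ge0// ler_pdivlMr ?exprn_gt0// mul1r.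
      have -> : 4 = 2 ^+ 2 :> R by rewrite expr2 -natrM.
      by rewrite ler_pXn2r ?nnegrE// ltW.
    by rewrite ler_wpM2l// psi2_ge_sqr.
  rewrite circle_meanD//; last 2 first.
  - by move=> t; rewrite mulr_ge0// psi2_ge0.
  - by apply: measurable_funM; [exact: measurable_cst|exact: measurable_psi2].
  rewrite circle_meanZ//; last 2 first.
  - by move=> t; exact: psi2_ge0.
  - exact: measurable_psi2.
  have -> : 5%:E = (1%:E + 4%:E * 1%:E)%E :> \bar R by rewrite mule1 -EFinD; congr EFin; ring.
  by rewrite leeD ?circle_mean_cst// lee_pmul2l.
(* The truncated means converge to a limit at most 5, so one of them is at most 6; the part above
   the truncation adds at most 1, for a total of 7. *)
have [j hj] : exists j, (circle_mean (h j) <= 6%:E)%E.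
  have cv : circle_mean (h j) @[j --> \oo] --> circle_mean hl.
    by apply: cvgeZl => //; exact: cvI.
  apply: contrapT => /forallNP no.
  have : (6%:E <= circle_mean hl)%E.
    apply: cvge_ge cv.
    by apply: nearW => j; rewrite leNgt; apply/negP => /ltW; exact: no.
  by move=> /le_trans/(_ Ihl); rewrite lee_fin; lra.
exists (rr j); split => //.
have mf1 : measurable_fun arc (fun t => normc (f ((rr j)%:C * expi t))).
  exact: measurable_circle_trace.
have ms : measurable_fun arc (fun t => Num.sqrt (normc (f ((rr j)%:C * expi t)))).
  by apply: measurableT_comp => //; by apply: continuous_measurable_fun; exact: sqrt_continuous.
apply: (@le_trans _ _ (circle_mean (fun t => h j t + M^-1 * normc (f ((rr j)%:C * expi t))))).
  apply: circle_mean_le => //.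
    apply: measurable_funD; first exact: mh.
    by apply: measurable_funM => //; exact: measurable_cst.
  move=> t _; rewrite /h /T; set x := normc _; have x0 : 0 <= x by exact: normc_nneg.
  have [sM|sM] := leP (Num.sqrt x) M; first by rewrite lerDl mulr_ge0// invr_ge0 ltW.
  rewrite ler_wpDl ?(ltW M1)// mulrC ler_pdivlMr// -{2}(sqr_sqrtr x0) expr2.
  by rewrite ler_wpM2l ?sqrtr_ge0// ltW.
rewrite circle_meanD//; last 2 first.
- by move=> t; rewrite mulr_ge0 ?normc_nneg// invr_ge0 ltW.
- by apply: measurable_funM => //; exact: measurable_cst.
rewrite circle_meanZ ?invr_ge0 ?(ltW M1)//; last by move=> t; exact: normc_nneg.
have -> : 7%:E = (6%:E + 1%:E)%E :> \bar R by rewrite -EFinD; congr EFin; ring.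
rewrite leeD// -(mulVf (lt0r_neq0 M1)) EFinM lee_pmul2l ?fM// lte_fin invr_gt0//.
Unshelve. all: end_near.
Qed.

(** On |z| = r >= 1/2 one has sqrt|quot f| <= 2 (sqrt|f(z)| + sqrt|f(0)|), and the mean value
    inequality bounds sqrt|f(0)| by m: the mean becomes at most 2 (m + m). *)
Lemma quot_sqrt_mean f r (m : R) : 2^-1 <= r < 1 -> smooth_on_disk f ->
  (circle_mean (fun t => Num.sqrt (normc (f (r%:C * expi t))))%R <= m%:E)%E ->
  Num.sqrt (normc (f 0)) <= m /\
  (circle_mean (fun t => Num.sqrt (normc (quot f (r%:C * expi t))))%R <= (m * 4)%:E)%E.
Proof.
move=> /andP[r2 r1] fs fm; have r0 : 0 < r by lra.
have r01 : 0 <= r < 1 by rewrite r1 ltW.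
have am : Num.sqrt (normc (f 0)) <= m.
  rewrite -lee_fin (le_trans _ fm)//; apply: submean_sqrt => //.
  by rewrite r0.
split => //.
have ms g : smooth_on_disk g ->
    measurable_fun arc (fun t => Num.sqrt (normc (g (r%:C * expi t)))).
  move=> gs; apply: measurableT_comp; last exact: measurable_circle_trace.
  by apply: continuous_measurable_fun; exact: sqrt_continuous.
apply: (@le_trans _ _ (circle_mean (fun t => 2 * (Num.sqrt (normc (f (r%:C * expi t))) + m)))).
  apply: circle_mean_le => //.
  - by apply: ms; exact: smooth_quot.
  - apply: measurable_funM; first exact: measurable_cst.
    by apply: measurable_funD; [exact: ms|exact: measurable_cst].
  move=> t _; have nr : normc (r%:C * expi t) = r by rewrite normc_polar// ltW.
  set z := r%:C * expi t in nr *.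
  have z0 : z != 0 by rewrite -normc_gt0 nr.
  apply: (@le_trans _ _ (2 * (Num.sqrt (normc (f z)) + Num.sqrt (normc (f 0))))); last first.
    by rewrite ler_wpM2l// lerD2l.
  rewrite quot_neq0// Normc.normcM Normc.normcV nr.
  rewrite -(ler_pXn2r (n := 2)) ?nnegrE ?sqrtr_ge0 ?mulr_ge0 ?addr_ge0 ?sqrtr_ge0//.
  rewrite sqr_sqrtr ?divr_ge0 ?normc_nneg ?(ltW r0)// ler_pdivrMr//.
  rewrite (le_trans (normc_triangleB _ _))//.
  rewrite -{1}(sqr_sqrtr (normc_nneg (f z))) -{1}(sqr_sqrtr (normc_nneg (f 0))).
  move: (Num.sqrt (normc (f z))) (Num.sqrt (normc (f 0)))
    (sqrtr_ge0 (normc (f z))) (sqrtr_ge0 (normc (f 0))) => a b a0 b0.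
  have -> : (2 * (a + b)) ^+ 2 * r = (4 * r) * (a ^+ 2 + b ^+ 2) + 8 * (r * (a * b)) by ring.
  rewrite ler_wpDr ?mulr_ge0 ?(ltW r0)// ler_peMl ?addr_ge0 ?sqr_ge0//; lra.
have m0 : 0 <= m by rewrite (le_trans _ am)// sqrtr_ge0.
rewrite circle_meanZ//; last 2 first.
- by move=> t; rewrite addr_ge0// sqrtr_ge0.
- by apply: measurable_funD; [exact: ms|exact: measurable_cst].
rewrite circle_meanD//; last exact: ms.
have -> : (m * 4)%:E = (2%:E * (m%:E + m%:E))%E :> \bar R.
  by rewrite -EFinD -EFinM; congr EFin; ring.
by rewrite lee_pmul2l// leeD// circle_mean_cst.
Qed.

(** A single radius serves all the quotients, giving sqrt|coefficient| <= 7 * 4^n, which is then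
    squared. The radius depends on f, the bound does not. *)
Lemma hardy_orlicz_taylor_bound f n : hardy_orlicz psi2 f -> hardy_orlicz_norm psi2 f <= 1 ->
  normc (taylor f n) <= 49 * 16 ^+ n.
Proof.
move=> fH fN; have [r [r12 fr]] := hardy_orlicz_radius fH fN.
have fs : smooth_on_disk f by case: fH => -[/analytic_smooth].
have H k : (circle_mean (fun t => Num.sqrt (normc (iter k (@quot R) f (r%:C * expi t))))%R <=
    (7 * 4 ^+ k)%:E)%E.
  elim: k => [|k IH]; first by rewrite expr0 mulr1.
  by rewrite exprSr mulrA; exact: (quot_sqrt_mean r12 (smooth_iter_quot k fs) IH).2.
have [+ _] := quot_sqrt_mean r12 (smooth_iter_quot n fs) (H n).
rewrite -(ler_pXn2r (n := 2)) ?nnegrE ?sqrtr_ge0 ?mulr_ge0 ?exprn_ge0//.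
rewrite sqr_sqrtr ?normc_nneg// => /le_trans; apply.
rewrite exprMn -exprM mulnC exprM.
have -> : 7 ^+ 2 = 49 :> R by ring.
by have -> : 4 ^+ 2 = 16 :> R by ring.
Qed.

End unit_ball.

(** * Compactness *)

Section compactness.
Variable R : realType.
Implicit Types (f g F phi : R[i] -> R[i]) (z w : R[i]) (r s t K : R).
Local Notation mu := (@lebesgue_measure R).
Local Notation arc := (@angles R).

Definition continuous_on_closed_disk F := forall z0, normc z0 <= 1 ->
  forall e : R, 0 < e -> exists d : R, 0 < d /\
    forall z, normc z <= 1 -> normc (z - z0) < d -> normc (F z - F z0) < e.

Lemma radial_limit F z : normc z = 1 -> continuous_on_closed_disk F ->
  F (r%:C * z) @[r --> (1 : R)^'-] --> F z.
Proof.
move=> z1 Fc; apply/cvg_normcP => e e0.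
have [d [d0 hd]] := Fc z ltac:(by rewrite z1) _ e0.
exists (Num.min d 1) => /=; first by rewrite lt_min d0 ltr01.
move=> r /=; rewrite lt_min => /andP[rd r1'] r1.
have r0 : 0 < r by move: r1'; rewrite ger0_norm ?subr_ge0 ?ltW//; lra.
rewrite normc_sub; apply: hd.
  by rewrite Normc.normcM z1 mulr1 normc_real gtr0_norm// ltW.
have -> : r%:C * z - z = (r - 1)%:C * z by rewrite rmorphB/=; ring.
by rewrite Normc.normcM z1 mulr1 normc_real distrC.
Qed.

Lemma boundary_closed F z : normc z = 1 -> continuous_on_closed_disk F ->
  boundary F z = F z.
Proof.
by move=> z1 Fc; apply: cvg_lim; [exact: norm_hausdorff|exact: radial_limit].
Qed.

Lemma circle_trace_continuous F : continuous_on_closed_disk F ->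
  continuous (fun t : R => complex.Re (F (expi t))) /\
  continuous (fun t : R => complex.Im (F (expi t))).
Proof.
move=> Fc.
have H t (e : R) : 0 < e -> \forall s \near t, normc (F (expi s) - F (expi t)) < e.
  move=> e0; have [d [d0 hd]] := Fc (expi t) ltac:(by rewrite expi_norm) _ e0.
  apply: filterS (expi_continuous t d0) => s; apply: hd.
  by rewrite expi_norm.
split=> t; apply/cvgrPdist_lt => e /(H t); apply: filterS => s;
  rewrite normc_sub; apply: le_lt_trans.
- rewrite (_ : complex.Re _ - _ = complex.Re (F (expi t) - F (expi s))) ?Re_le_normc//.
  by case: (F (expi t)) => a b; case: (F (expi s)).
- rewrite (_ : complex.Im _ - _ = complex.Im (F (expi t) - F (expi s))) ?Im_le_normc//.
  by case: (F (expi t)) => a b; case: (F (expi s)).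
Qed.

Lemma boundary_measurable F : continuous_on_closed_disk F ->
  circle_measurable (boundary F).
Proof.
move=> Fc; have [cR cI] := circle_trace_continuous Fc.
split.
  rewrite (_ : (fun t => _) = fun t => complex.Re (F (expi t))).
    exact: measurable_continuous.
  by apply/funext => t; rewrite boundary_closed// expi_norm.
rewrite (_ : (fun t => _) = fun t => complex.Im (F (expi t))).
  exact: measurable_continuous.
by apply/funext => t; rewrite boundary_closed// expi_norm.
Qed.

Lemma psi2_le (x y : R) : 0 <= x -> x <= y -> psi2 x <= psi2 y.
Proof.
move=> x0 xy; rewrite /psi2 lerB// ler_expR ler_pXn2r ?nnegrE//.
exact: le_trans xy.
Qed.

(** exp(-1/4) >= 3/4, so exp(1/4) <= 4/3. *)
Lemma psi2_half : psi2 (2^-1 : R) <= 1.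
Proof.
rewrite /psi2 lerBlDr.
have h := expR_ge1Dx (- (2^-1 : R) ^+ 2); rewrite expRN in h.
have e0 := expR_gt0 ((2^-1 : R) ^+ 2).
have : (1 - (2^-1 : R) ^+ 2) * expR (2^-1 ^+ 2) <= 1 by rewrite -ler_pdivlMr// mul1r.
have -> : (2^-1 : R) ^+ 2 = 4^-1 by rewrite exprVn -natrX.
by lra.
Qed.

(** A sup bound e on the closed disk makes 2e an admissible Luxemburg constant; through this,
    uniform convergence yields convergence in norm. *)
Lemma modular_closed F (e : R) : 0 < e -> continuous_on_closed_disk F ->
  (forall z, normc z <= 1 -> normc (F z) <= e) ->
  (orlicz_modular psi2 (boundary F) (e * 2) <= 1)%E.
Proof.
move=> e0 Fc Fe; rewrite /orlicz_modular circle_meanE -(circle_mean_cst 1).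
apply: circle_mean_le => //.
- by move=> t; exact: psi2_ge0.
- by apply: measurable_psi2; exact: boundary_measurable.
move=> t _; rewrite boundary_closed ?expi_norm// (le_trans _ psi2_half)// psi2_le//.
  by rewrite divr_ge0 ?normc_nneg ?mulr_ge0// ltW.
by rewrite ler_pdivrMr ?mulr_gt0// mulrCA mulVf ?mulr1// Fe ?expi_norm.
Qed.

Lemma hardy_orlicz_closed F (M : R) : smooth_on_disk F -> continuous_on_closed_disk F ->
  (forall z, normc z <= 1 -> normc (F z) <= M) -> hardy_orlicz psi2 F.
Proof.
move=> Fs Fc FM; split.
- split; first exact: smooth_analytic.
  exists M => r /andP[r0 r1]; rewrite circle_meanE -(circle_mean_cst M).
  apply: circle_mean_le => //.
  + by move=> t; exact: normc_nneg.
  + by apply: measurable_circle_trace => //; rewrite r0.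
  by move=> t _; apply: FM; rewrite normc_polar// ltW.
- apply: aeW => t _; apply/cvg_ex; exists (F (expi t)).
  by apply: radial_limit => //; exact: expi_norm.
split; first exact: boundary_measurable.
have M0 : 0 <= M by rewrite (le_trans _ (FM 0 _)) ?normc_nneg// Normc.normc0.
have M1 : 0 < M + 1 by rewrite ltr_wpDl.
exists ((M + 1) * 2); split; first by rewrite mulr_gt0.
apply: (@le_lt_trans _ _ 1%E); last exact: ltry.
by apply: modular_closed => // z /FM /le_trans; apply; rewrite lerDl.
Qed.

Lemma hardy_orlicz_norm_closed F (e : R) : 0 < e -> continuous_on_closed_disk F ->
  (forall z, normc z <= 1 -> normc (F z) <= e) ->
  0 <= hardy_orlicz_norm psi2 F <= e * 2.
Proof.
move=> e0 Fc Fe; have mF := modular_closed e0 Fc Fe.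
have e2 : 0 < e * 2 by rewrite mulr_gt0.
rewrite /hardy_orlicz_norm /luxemburg_norm; apply/andP; split.
  by apply: lb_le_inf; [exists (e * 2)|move=> c [/ltW]].
by apply: ge_inf; [exists 0 => c [/ltW]|].
Qed.

Lemma comp_continuous_closed f phi r : continuous_on_closed_disk phi ->
  (forall z, normc z <= 1 -> normc (phi z) <= r) ->
  (forall w, normc w <= r -> jet 1 f w) -> continuous_on_closed_disk (f \o phi).
Proof.
move=> pc pr fj z0 z01 e e0.
have [d [d0 hd]] := jet_continuous (fj _ (pr _ z01)) e0.
have [d' [d'0 hd']] := pc _ z01 _ d0.
by exists d'; split => // z z1 zd; apply: hd; exact: hd'.
Qed.

Lemma sub_continuous_closed F G : continuous_on_closed_disk F ->
  continuous_on_closed_disk G -> continuous_on_closed_disk (F \- G).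
Proof.
move=> Fc Gc z0 z01 e e0; have e2 : 0 < e / 2 by rewrite divr_gt0.
have [d [d0 hd]] := Fc _ z01 _ e2; have [d' [d'0 hd']] := Gc _ z01 _ e2.
exists (Num.min d d'); split; first by rewrite lt_min d0.
move=> z z1; rewrite lt_min => /andP[zd zd'] /=.
have -> : F z - G z - (F z0 - G z0) = (F z - F z0) - (G z - G z0) by ring.
rewrite (le_lt_trans (normc_triangleB _ _))// (splitr e) ltrD//.
  exact: hd.
exact: hd'.
Qed.

(** Regularity of f is asked only on a disk containing the range of [phi], because the limit
    function in [composition_compact] is a power series controlled only near 0. *)
Lemma comp_hardy_orlicz f phi r : 0 <= r -> smooth_on_disk phi ->
  continuous_on_closed_disk phi ->
  (forall z, normc z <= 1 -> normc (phi z) <= r) ->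
  (forall w n, normc w <= r -> jet n f w) -> hardy_orlicz psi2 (f \o phi).
Proof.
move=> r0 ps pc pr fj.
have [M hM] := smooth_bounded r0 (fun w wr => fj w 1%N wr).
apply: (@hardy_orlicz_closed _ M).
- move=> z zd n; apply: jet_comp; last exact: ps.
  by apply: fj; apply: pr; exact: ltW.
- by apply: comp_continuous_closed pc pr _ => w; exact: fj.
- by move=> z /pr /hM.
Qed.

(** The image of U under u is an ultrafilter containing the compact segment [-K, K], hence it
    converges. *)
Lemma bounded_ultra_cvg (U : set_system nat) (u : nat -> R) K : UltraFilter U ->
  (forall n, `|u n| <= K) -> exists l : R, u @ U --> l.
Proof.
move=> UU uK.
have uU : UltraFilter (u @ U).
  split=> [|G GP sG]; first exact: fmap_proper_filter.
  apply/seteqP; split=> // A GA.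
  have [//|UnA] := in_ultra_setVsetC (u @^-1` A) UU.
  by have [x []] := filter_ex (filterI GA (sG (~` A) UnA)).
have := @segment_compact R (- K) K; rewrite compact_ultra => /(_ (u @ U) uU).
case=> [|l [_ hl]]; last by exists l.
rewrite -[_ `[- K, K]%classic]/(U (u @^-1` `[- K, K]%classic)).
by apply: filterE => n; rewrite /= in_itv/= -ler_norml; exact: uK.
Qed.

Lemma bounded_ultra_cvgC (U : set_system nat) (u : nat -> R[i]) K : UltraFilter U ->
  (forall n, normc (u n) <= K) -> exists l : R[i], u @ U --> l.
Proof.
move=> UU uK.
have [a ha] := bounded_ultra_cvg UU (fun n => le_trans (Re_le_normc _) (uK n)).
have [b hb] := bounded_ultra_cvg UU (fun n => le_trans (Im_le_normc _) (uK n)).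
by exists (a +i* b); exact: cvg_ReIm.
Qed.

(** An ultrafilter finer than [\oo] provides all the limits l_k at once, in place of nested
    subsequences. Finitely many closeness conditions and the condition of lying past a given index
    define a member of it, hence a nonempty set. *)
Lemma diagonal_subsequence (a : nat -> nat -> R[i]) (K : nat -> R) :
  (forall n k, normc (a n k) <= K k) ->
  exists (s : nat -> nat) (l : nat -> R[i]),
    [/\ {homo s : m n / (m < n)%N}, forall k, normc (l k) <= K k &
      forall m k, (k < m)%N -> normc (a (s m) k - l k) <= m.+1%:R^-1].
Proof.
move=> aK.
have [U [UU sU]] := @ultraFilterLemma nat \oo _.
have /choice[l hl] : forall k, exists l : R[i], (a ^~ k) @ U --> l.
  by move=> k; apply: (@bounded_ultra_cvgC U _ (K k)).
have lK k : normc (l k) <= K k.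
  apply/ler_addgt0Pl => e e0; have /cvg_normcP/(_ _ e0) h := hl k.
  have [n hn] := filter_ex h.
  rewrite -(subrK (a n k) (l k)) (le_trans (normc_triangle _ _))// lerD//.
  exact: ltW.
pose P m n := forall k, (k < m)%N -> normc (a n k - l k) <= m.+1%:R^-1.
have UP m j : U [set n | (j < n)%N /\ P m n].
  apply: filterI; first by apply: sU; exists j.+1.
  rewrite /P.
  have H k : U [set n | normc (a n k - l k) <= m.+1%:R^-1].
    have /cvg_normcP/(_ m.+1%:R^-1) := hl k; rewrite invr_gt0 => /(_ (ltr0Sn _ _)).
    by apply: filterS => n; rewrite /= normc_sub => /ltW.
  have : forall i, U [set n | forall k, (k < i)%N -> normc (a n k - l k) <= m.+1%:R^-1].
    elim=> [|i IH]; first by apply: filterE.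
    apply: filterS2 (H i) IH => n h1 h2 k; rewrite ltnS leq_eqVlt => /orP[/eqP->//|].
    exact: h2.
  exact.
have /choice[nx hnx] : forall mj : nat * nat, exists n, (mj.2 < n)%N /\ P mj.1 n.
  by move=> [m j]; exact: filter_ex (UP m j).
(* Each index is taken past the previous one and within the tolerance of its own rank; at rank 0 the
   closeness condition is vacuous. *)
pose s := fix s m := if m is m'.+1 then nx (m, s m') else nx (0%N, 0%N).
exists s, l; split => //.
  by apply: homo_ltn => [x y z|m]; [exact: ltn_trans|exact: (hnx (m.+1, s m)).1].
by case=> [//|m]; exact: (hnx (m.+1, s m)).2.
Qed.

Lemma composition_compact phi : smooth_on_disk phi ->
  continuous_on_closed_disk phi ->
  (forall z, normc z <= 1 -> normc (phi z) <= 64^-1) ->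
  compact_operator (hardy_orlicz psi2) (hardy_orlicz_norm psi2)
    (composition_operator phi).
Proof.
move=> ps pc pb.
have H64 : (0 : R) <= 64^-1 by rewrite invr_ge0.
have in_disk w : normc w <= 64^-1 -> disk w.
  by move=> h; rewrite /disk/= (le_lt_trans h)//; lra.
have Xs f : hardy_orlicz psi2 f -> smooth_on_disk f by case=> -[/analytic_smooth].
split=> [f /Xs fs|u uX].
  by apply: (comp_hardy_orlicz H64 ps pc pb) => w n /in_disk /fs.
have [s [l [smono lK hl]]] := diagonal_subsequence
  (fun n k => hardy_orlicz_taylor_bound k (uX n).1 (uX n).2).
have cb (c : nat -> R[i]) : (forall k, normc (c k) <= 49 * 16 ^+ k) -> coef_bound c 16^-1 49.
  move=> h k; rewrite exprVn ler_pdivrMr ?exprn_gt0//.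
have lcb := cb _ lK.
have w16 w : normc w <= 64^-1 -> normc w < 16^-1 by move=> h; rewrite (le_lt_trans h)//; lra.
have lj w n : normc w <= 64^-1 -> jet n (psum l) w.
  by move=> /w16 h; apply: jet_pseries (lcb) h _ => z; exact: psum_cvg.
exists s, (psum l \o phi); split => //; first exact: (comp_hardy_orlicz H64 ps pc pb).
have [C [C0 est]] : exists C : R, 0 < C /\ forall m w, normc w <= 64^-1 ->
    normc (u (s m) w - psum l w) <= C * m.+1%:R^-1.
  (* Each of the two tails from rank m on is at most 98 / (m+1), from 49 * 4^-m * 2, and the first m
     coefficients contribute at most 2 / (m+1): 198 in all. *)
  exists 200; split => // m w w64; have ww := w16 _ w64.
  set f := u (s m); have [fX fN] := uX (s m).
  have fcb := cb _ (fun k => hardy_orlicz_taylor_bound k fX fN).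
  have w4 : normc w < 4^-1 by rewrite (lt_trans ww)//; lra.
  have t1 := psum_tail m fcb ww (taylor_series (Xs _ fX) w4).
  have t2 := psum_tail m lcb ww (psum_cvg lcb ww).
  have q0 : 0 <= normc w / 16^-1 by rewrite divr_ge0// normc_nneg.
  have q4 : normc w / 16^-1 <= 4^-1 by rewrite invrK; lra.
  have m0 : 0 < (m.+1%:R : R)^-1 by rewrite invr_gt0.
  have tail : 49 * (normc w / 16^-1) ^+ m / (1 - normc w / 16^-1) <= 98 * m.+1%:R^-1.
    have i2 : (1 - normc w / 16^-1)^-1 <= 2 by rewrite -[leRHS]invrK lef_pV2 ?posrE; lra.
    have im : (normc w / 16^-1) ^+ m <= m.+1%:R^-1.
      apply: (@le_trans _ _ (4^-1 ^+ m)); first by rewrite lerXn2r ?nnegrE//; lra.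
      rewrite exprVn lef_pV2 ?posrE ?exprn_gt0// -natrX ler_nat.
      by rewrite (leq_trans (ltn_expl m (isT : (1 < 4)%N))).
    have -> : 98 * m.+1%:R^-1 = 49 * m.+1%:R^-1 * 2 :> R by ring.
    rewrite ler_pM ?mulr_ge0 ?exprn_ge0 ?invr_ge0//; first by lra.
    by rewrite ler_wpM2l.
  have mid : normc (\sum_(k < m) taylor f k * w ^+ k - \sum_(k < m) l k * w ^+ k) <= 2 * m.+1%:R^-1.
    rewrite -sumrB (le_trans (normc_sum _ _ _))//.
    apply: (@le_trans _ _ (\sum_(k < m) m.+1%:R^-1 * 2^-1 ^+ k)).
      apply: ler_sum => k _; rewrite -mulrBl Normc.normcM normc_exp.
      rewrite ler_pM ?exprn_ge0 ?normc_nneg ?hl// lerXn2r ?nnegrE ?normc_nneg//; lra.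
    rewrite -mulr_sumr mulrC ler_wpM2r ?(ltW m0)//.
    have := @geometric_sum_le R 2^-1 m; have -> : (1 - 2^-1 : R)^-1 = 2.
      by rewrite -[RHS]invrK; congr (_^-1); lra.
    by apply; lra.
  set S1 := \sum_(k < m) taylor f k * w ^+ k in t1 mid.
  set S2 := \sum_(k < m) l k * w ^+ k in t2 mid.
  have -> : f w - psum l w = (f w - S1) + (S1 - S2) - (psum l w - S2) by ring.
  rewrite (le_trans (normc_triangleB _ _))//.
  have tr := normc_triangle (f w - S1) (S1 - S2).
  have {}t1 := le_trans t1 tail; have {}t2 := le_trans t2 tail.
  move: (normc (f w - S1)) (normc (S1 - S2)) (normc (psum l w - S2))
    (normc (f w - S1 + (S1 - S2))) (m.+1%:R^-1) m0 tr t1 t2 mid => x1 x2 x3 x4 y; lra.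
have cl : continuous_on_closed_disk (psum l \o phi).
  by apply: comp_continuous_closed pc pb _ => w; exact: lj.
apply: (@squeeze_cvgr _ _ _ _ (cst 0) (fun m => C * harmonic m * 2)).
- apply: nearW => m; apply: hardy_orlicz_norm_closed; first by rewrite mulr_gt0// invr_gt0.
    apply: sub_continuous_closed => //.
    by apply: comp_continuous_closed pc pb _ => w /in_disk /(Xs _ (uX (s m)).1); exact.
  by move=> z /pb h; exact: est.
- exact: cvg_cst.
rewrite -(mul0r 2) -[in X in X * 2](mulr0 C).
by apply: cvgM; [apply: cvgM; [exact: cvg_cst|exact: cvg_harmonic]|exact: cvg_cst].
Qed.

End compactness.

(** * A lacunary series of infinite energy *)

Section lacunary.
Variable R : realType.
Implicit Types (f g F phi : R[i] -> R[i]) (z w : R[i]) (r s t K : R).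

Definition freq j := (256 ^ j)%N.

(** The amplitudes sum to 1/64, whence continuity and the size of the range, whereas
    [amp j * freq j] grows like 128^j. *)
Definition amp j : R := 2^-1 ^+ j / 128.

Definition lac z : R[i] := lim (series (fun j => (amp j)%:C * z ^+ freq j) @ \oo).

(** These are the coefficients of [lac] as an ordinary power series: k is a frequency exactly when
    it equals 256 to the power of its truncated logarithm. The index 0 gets 0, since [freq 0] is
    1. *)
Definition lac_coef k : R[i] :=
  if k == freq (trunc_log 256 k) then (amp (trunc_log 256 k))%:C else 0.

Lemma freq_gt0 j : (0 < freq j)%N. Proof. by rewrite /freq expn_gt0. Qed.

Lemma freqS j : freq j.+1 = (256 * freq j)%N. Proof. by rewrite /freq expnS. Qed.

Lemma ltn_freqS j : (freq j < freq j.+1)%N.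
Proof. by rewrite /freq ltn_exp2l. Qed.

(** The linear bound 256^k > 128 k is enough for [lac_tail_sum]; strictness absorbs the lowering of
    the exponent by differentiation. *)
Lemma freqD_ge n k : (freq n * (128 * k) < freq (n + k))%N.
Proof.
rewrite /freq expnD ltn_pmul2l ?expn_gt0//.
elim: k => [|k IH]; first by rewrite muln0.
rewrite expnS mulnS (@leq_trans (128 * 256 ^ k + 128 * 256 ^ k)%N)//.
  rewrite -addnS leq_add//; first by rewrite leq_pmulr// expn_gt0.
  by rewrite (leq_trans IH)// leq_pmull.
by rewrite -mulnDl leq_mul2r orbC.
Qed.

Lemma freqR j : ((freq j)%:R : R) = 256 ^+ j.
Proof. by rewrite /freq natrX. Qed.

Lemma amp_gt0 j : 0 < amp j.
Proof. by rewrite divr_gt0// exprn_gt0. Qed.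

Lemma amp_freq j : amp j * (freq j)%:R = 128 ^+ j / 128.
Proof.
rewrite freqR /amp mulrAC -exprMn; congr (_ ^+ _ / _).
by rewrite mulrC -[256]/((2 * 128)%:R) natrM mulrAC mulfV ?mul1r.
Qed.

Lemma normc_amp j z : normc z <= 1 -> normc ((amp j)%:C * z ^+ freq j) <= amp j.
Proof.
move=> z1; rewrite Normc.normcM normc_real gtr0_norm ?amp_gt0// normc_exp.
by rewrite ler_piMr ?(ltW (amp_gt0 j))// exprn_ile1// normc_nneg.
Qed.

Lemma sum_amp m n : \sum_(j < n) amp (m + j)%N <= 2^-1 ^+ m / 64.
Proof.
have -> : \sum_(j < n) amp (m + j)%N = amp m * \sum_(j < n) 2^-1 ^+ j.
  rewrite mulr_sumr; apply: eq_bigr => j _; rewrite /amp exprD; ring.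
apply: (@le_trans _ _ (amp m * (1 - 2^-1)^-1)).
  rewrite ler_wpM2l ?(ltW (amp_gt0 m))// geometric_sum_le//; lra.
by rewrite le_eqVlt; apply/orP; left; apply/eqP; rewrite /amp; field.
Qed.

Lemma lac_cvg z : normc z <= 1 ->
  series (fun j => (amp j)%:C * z ^+ freq j) @ \oo --> lac z.
Proof.
move=> z1.
suff : cvgn (series (fun j => (amp j)%:C * z ^+ freq j)) by [].
apply: (@cvg_dominated_series _ _ (geometric 128^-1 2^-1)) => [n|].
  by rewrite (le_trans (normc_amp n z1))// /amp /= mulrC.
by apply: is_cvg_geometric_series; rewrite ger0_norm; lra.
Qed.

Definition lac_part m z : R[i] := \sum_(j < m) (amp j)%:C * z ^+ freq j.

Lemma lac_tail m z : normc z <= 1 -> normc (lac z - lac_part m z) <= 2^-1 ^+ m / 64.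
Proof.
move=> z1; have /cvgn_normcP h := lac_cvg z1.
apply: (@cvgn_normc_le _ (fun n => series (fun j => (amp j)%:C * z ^+ freq j) n -
   lac_part m z) _ _ m).
  move=> n mn; rewrite /series/= big_mkord -(subnKC mn) big_split_ord/= addrAC subrr add0r.
  rewrite (le_trans (normc_sum _ _ _))// (le_trans _ (sum_amp m (n - m)))//.
  by apply: ler_sum => j _; exact: normc_amp.
apply/cvgn_normcP => e /h [N hN]; exists N => n /hN.
rewrite (_ : _ - _ - _ = lac z - series (fun j => (amp j)%:C * z ^+ freq j) n)//; ring.
Qed.

Lemma lac_bound z : normc z <= 1 -> normc (lac z) <= 64^-1.
Proof.
by move=> /(lac_tail 0); rewrite /lac_part big_ord0 subr0 expr0 mul1r.
Qed.

Lemma jet_exp n m z0 : jet n (fun z => z ^+ m) z0.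
Proof.
elim: m => [|m IH].
  by apply: (@jet_local _ _ (fun=> 1) _ _ 1) => //; exact: jet_cst.
apply: (@jet_local _ _ (fun z => z * z ^+ m) _ _ 1) => // [z _|].
  by rewrite exprS.
by apply: jetM => //; exact: jet_id.
Qed.

Lemma jet_sum n m (f : nat -> R[i] -> R[i]) z0 : (forall i, jet n (f i) z0) ->
  jet n (fun z => \sum_(i < m) f i z) z0.
Proof.
move=> fj; elim: m => [|m IH].
  by apply: (@jet_local _ _ (fun=> 0) _ _ 1) => // [z _|]; [rewrite big_ord0|exact: jet_cst].
apply: (@jet_local _ _ (fun z => (\sum_(i < m) f i z) + f m z) _ _ 1) => // [z _|].
  by rewrite big_ord_recr.
exact: jetD.
Qed.

Lemma lac_continuous : continuous_on_closed_disk lac.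
Proof.
move=> z0 z01 e e0.
have q2 : `|2^-1 : R| < 1 by rewrite ger0_norm; lra.
have e3 : 0 < e / 3 by rewrite divr_gt0.
have /cvgrPdist_lt/(_ _ e3)[N _ hN] := cvg_geometric (64^-1 : R) q2.
have {}hN : 2^-1 ^+ N / 64 < e / 3.
  by have := hN N (leqnn N); rewrite /= sub0r normrN mulrC ger0_norm// mulr_ge0// exprn_ge0.
have [|d [d0 hd]] := @jet_continuous _ (lac_part N) z0 _ _ e3.
  apply: (@jet_sum 1 N (fun j z => (amp j)%:C * z ^+ freq j)) => i.
  by apply: jetM; [exact: jet_cst|exact: jet_exp].
exists d; split => // z z1 /hd h.
have t1 := le_lt_trans (lac_tail N z1) hN; have t2 := le_lt_trans (lac_tail N z01) hN.
have split3 (x y u v : R[i]) : x - y = (x - u) + (u - v) - (y - v) by ring.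
rewrite (split3 _ _ (lac_part N z) (lac_part N z0)).
rewrite (le_lt_trans (normc_triangleB _ _))//.
have -> : e = e / 3 + e / 3 + e / 3 by lra.
by rewrite ltrD// (le_lt_trans (normc_triangle _ _))// ltrD.
Qed.

Lemma lac_coef_bound : coef_bound lac_coef 1 1.
Proof.
move=> k; rewrite expr1n mulr1 /lac_coef; case: ifP => _; last by rewrite Normc.normc0.
rewrite normc_real gtr0_norm ?amp_gt0// /amp ler_pdivrMr// mul1r.
by apply: (@le_trans _ _ 1); [apply: exprn_ile1; lra|lra].
Qed.

Lemma lac_coef_sum m z :
  \sum_(0 <= k < freq m) lac_coef k * z ^+ k = lac_part m z.
Proof.
rewrite /lac_part; elim: m => [|m IH].
  by rewrite big_ord0 big_nat1 /lac_coef trunc_log0 mul0r.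
rewrite big_ord_recr/= -IH (big_cat_nat (n := freq m))//; last exact/ltnW/ltn_freqS.
congr (_ + _); rewrite big_ltn ?ltn_freqS//=.
have -> : lac_coef (freq m) = (amp m)%:C by rewrite /lac_coef /freq trunc_expnK// eqxx.
rewrite big_nat big1 ?addr0// => k /andP[k1 k2].
rewrite /lac_coef (@trunc_log_eq 256 m)//; last by rewrite (ltnW k1).
by rewrite gtn_eqF ?mul0r.
Qed.

(** The partial sums of the lacunary series are those of the power series at the ranks [freq n]; as
    the power series converges, both limits agree. *)
Lemma lac_power_series z : normc z < 1 ->
  series (fun k => lac_coef k * z ^+ k) @ \oo --> lac z.
Proof.
move=> z1; have h := psum_cvg lac_coef_bound z1.
suff -> : lac z = psum lac_coef z by [].
apply: cvgn_unique (lac_cvg (ltW z1)) _; apply/cvgn_normcP => e e0.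
move/cvgn_normcP : h => /(_ _ e0)[N hN]; exists N => n Nn.
have := hN (freq n) (leq_trans Nn (ltnW (ltn_expl n (isT : (1 < 256)%N)))).
by rewrite /series/= lac_coef_sum /lac_part big_mkord.
Qed.

Lemma lac_smooth : smooth_on_disk lac.
Proof.
move=> z zd n; apply: (jet_pseries n lac_coef_bound zd) => w.
exact: lac_power_series.
Qed.

End lacunary.

(** * Comparison of integrals of nonnegative functions *)

Section nonneg_integral.
Context d (T : measurableType d) (R : realType) (mu : {measure set T -> \bar R}).
Local Open Scope ereal_scope.

(** The integral of a nonnegative function is a supremum over the simple functions below it, so
    monotonicity holds for arbitrary f and g. The energy integrands, built from [derive1], are
    compared on this ground. *)
Lemma nonneg_integral_le (f g : T -> \bar R) : (forall x, 0 <= f x) ->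
  (forall x, f x <= g x) -> \int[mu]_x f x <= \int[mu]_x g x.
Proof.
move=> f0 fg; have g0 x : 0 <= g x := le_trans (f0 x) (fg x).
rewrite !ge0_integralTE//; apply: le_ereal_sup => _ [h /= hf <-].
by exists h => // x; exact: le_trans (fg x).
Qed.

Lemma integral_ge_cst (D Q : set T) (f : T -> \bar R) (c : R) : measurable Q ->
  Q `<=` D -> (0 <= c)%R -> (forall x, D x -> 0 <= f x) ->
  (forall x, Q x -> c%:E <= f x) -> c%:E * mu Q <= \int[mu]_(x in D) f x.
Proof.
move=> mQ QD c0 f0 cf; rewrite -integral_cst// !(integral_mkcond Q) (integral_mkcond D).
apply: nonneg_integral_le => x; rewrite !patchE.
  by case: ifP => // _; rewrite lee_fin.
case: ifPn => [|_]; first by rewrite inE => Qx; rewrite mem_set ?cf//; exact: QD.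
by case: ifPn => //; rewrite inE; exact: f0.
Qed.

Lemma integral_le_cst (D Q : set T) (f : T -> \bar R) (c : R) : measurable Q ->
  D `<=` Q -> (0 <= c)%R -> (forall x, D x -> 0 <= f x <= c%:E) ->
  \int[mu]_(x in D) f x <= c%:E * mu Q.
Proof.
move=> mQ DQ c0 f0; rewrite -integral_cst// !(integral_mkcond Q) (integral_mkcond D).
apply: nonneg_integral_le => x; rewrite !patchE.
  by case: ifPn => //; rewrite inE => /f0/andP[].
case: ifPn => [|_]; first by rewrite inE => Dx; rewrite mem_set; [case/andP: (f0 _ Dx)|exact: DQ].
by case: ifP => // _; rewrite lee_fin.
Qed.

End nonneg_integral.

(** * Derivative and Dirichlet energy of the lacunary series *)

Section energy.
Variable R : realType.
Implicit Types (f g F phi : R[i] -> R[i]) (z w : R[i]) (r s t K x y : R).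
Local Notation mu2 := ((@lebesgue_measure R) \x (@lebesgue_measure R))%E.

Lemma normc_powB z z0 (rho : R) N : normc z <= rho -> normc z0 <= rho ->
  normc (z ^+ N - z0 ^+ N) <= normc (z - z0) * (N%:R * rho ^+ N.-1).
Proof.
move=> zr z0r; rewrite subrXX Normc.normcM ler_wpM2l ?normc_nneg//.
rewrite (le_trans (normc_sum _ _ _))// (@le_trans _ _ (\sum_(i < N) rho ^+ N.-1))//; last first.
  by rewrite sumr_const card_ord mulr_natl.
apply: ler_sum => i _; rewrite Normc.normcM !normc_exp.
have -> : rho ^+ N.-1 = rho ^+ (N.-1 - i) * rho ^+ i.
  by rewrite -exprD subnK// -ltnS (leq_trans (ltn_ord i))// leqSpred.
by rewrite ler_pM ?exprn_ge0 ?normc_nneg// lerXn2r ?nnegrE ?normc_nneg ?(le_trans (normc_nneg z)).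
Qed.

(** T bounds the partial sums of the differentiated tail at radius rho. Estimating differences term
    by term before taking the limit avoids differentiating the series. *)
Lemma lac_tail_lipschitz m z z0 (rho T : R) : rho <= 1 ->
  normc z <= rho -> normc z0 <= rho ->
  (forall n, \sum_(j < n) amp R (m + j) * ((freq (m + j))%:R * rho ^+ (freq (m + j)).-1) <= T) ->
  normc ((lac z - lac_part m z) - (lac z0 - lac_part m z0)) <= normc (z - z0) * T.
Proof.
move=> r1 zr z0r hT.
have /cvgn_normcP h := lac_cvg (le_trans zr r1).
have /cvgn_normcP h0 := lac_cvg (le_trans z0r r1).
pose S w n := series (fun j => (amp R j)%:C * w ^+ freq j) n.
apply: (@cvgn_normc_le _ (fun n => (S z n - lac_part m z) - (S z0 n - lac_part m z0)) _ _ m).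
  move=> n mn; rewrite /S /series/= !big_mkord -(subnKC mn) !big_split_ord/=.
  rewrite ![lac_part m _ + _ - _]addrAC !subrr !add0r -sumrB.
  rewrite (le_trans (normc_sum _ _ _))//.
  apply: (@le_trans _ _ (normc (z - z0) * \sum_(j < n - m) amp R (m + j) *
    ((freq (m + j))%:R * rho ^+ (freq (m + j)).-1))); last first.
    by rewrite ler_wpM2l ?normc_nneg.
  rewrite mulr_sumr; apply: ler_sum => j _.
  rewrite -mulrBr Normc.normcM normc_real gtr0_norm ?amp_gt0// mulrCA.
  by rewrite ler_wpM2l ?(ltW (amp_gt0 _ _))// normc_powB.
apply/cvgn_normcP => e e0; have e2 : 0 < e / 2 by rewrite divr_gt0.
have [N1 h1] := h _ e2; have [N2 h2] := h0 _ e2; exists (maxn N1 N2) => n.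
rewrite geq_max => /andP[/h1 n1 /h2 n2].
have regroup (a b c d p q : R[i]) :
  a - p - (b - q) - (c - p - (d - q)) = (a - c) - (b - d) by ring.
rewrite regroup.
by rewrite (le_lt_trans (normc_triangleB _ _))// (splitr e) ltrD.
Qed.

(** The divided difference of the tail at z0 is at most T by [lac_tail_lipschitz], and it differs
    from its value at z0, which is the left-hand side, by less than e at a close enough point. *)
Lemma lac_derive_approx m z0 (rho T : R) : rho <= 1 -> normc z0 < rho ->
  (forall n, \sum_(j < n) amp R (m + j) * ((freq (m + j))%:R * rho ^+ (freq (m + j)).-1) <= T) ->
  normc (derive1 (@lac R) z0 -
    \sum_(j < m) (amp R j)%:C * ((freq j)%:R * z0 ^+ (freq j).-1)) <= T.
Proof.
move=> r1 z0r hT.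
have z0d : disk z0 by rewrite /disk/= (lt_le_trans z0r).
have [g [gj0 [d [d0 gE]]]] := lac_smooth z0d 2.
have gj : jet 1 g z0 := gj0.
rewrite (derive1_eq_slope d0 gj gE).
(* The divided difference at z0 of the polynomial part, in closed form; at z0 it is the derivative
   of that part. *)
pose Q z := \sum_(j < m) (amp R j)%:C * (\sum_(i < freq j) z ^+ ((freq j).-1 - i) * z0 ^+ i).
have QE z : lac_part m z - lac_part m z0 = (z - z0) * Q z.
  rewrite /lac_part -sumrB mulr_sumr; apply: eq_bigr => j _.
  by rewrite -mulrBr subrXX; ring.
have Q0 : Q z0 = \sum_(j < m) (amp R j)%:C * ((freq j)%:R * z0 ^+ (freq j).-1).
  apply: eq_bigr => j _; congr (_ * _).
  rewrite (eq_bigr (fun=> z0 ^+ (freq j).-1)) => [|i _].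
    by rewrite sumr_const card_ord mulr_natl.
  by rewrite -exprD subnK// -ltnS (leq_trans (ltn_ord i))// leqSpred.
have Qj : jet 1 Q z0.
  apply: (@jet_sum _ 1 m (fun j z => (amp R j)%:C * (\sum_(i < freq j) z ^+ ((freq j).-1 - i) * z0 ^+ i))).
  move=> j; apply: jetM; first exact: jet_cst.
  apply: (@jet_sum _ 1 (freq j) (fun i z => z ^+ ((freq j).-1 - i) * z0 ^+ i)) => i.
  by apply: jetM; [exact: jet_exp|exact: jet_cst].
rewrite -Q0; apply/ler_addgt0Pl => e e0.
have [d' [d'0 hd']] := jet_continuous (jetB gj Qj) e0.
pose dd := Num.min (Num.min d d') (rho - normc z0) / 2.
have dd2 : 0 < dd * 2 by rewrite divfK// !lt_min d0 d'0 subr_gt0.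
have dd0 : 0 < dd by rewrite -(pmulr_lgt0 _ (ltr0Sn R 1)).
have : dd < dd * 2 by rewrite mulr_natr mulr2n ltrDl.
rewrite {2}/dd divfK// !lt_min => /andP[/andP[l0 l1] l2].
pose z := z0 + dd%:C.
have nz : normc (z - z0) = dd by rewrite /z addrAC subrr add0r normc_real gtr0_norm.
have zr : normc z <= rho.
  by rewrite (le_trans (normc_triangle _ _))// normc_real gtr0_norm//; lra.
have gz := gE z ltac:(by rewrite nz).
have hz := hd' z ltac:(by rewrite nz).
have L := lac_tail_lipschitz r1 zr (ltW z0r) hT.
have {}L : normc (g z - Q z) <= T.
  rewrite -(ler_pM2l dd0) -{1}nz -Normc.normcM mulrBr -QE -nz (le_trans _ L)//.
  by rewrite le_eqVlt; apply/orP; left; apply/eqP; congr normc; rewrite gz; ring.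
have -> : g z0 - Q z0 = (g z - Q z) - ((g z - Q z) - (g z0 - Q z0)) by ring.
by rewrite (le_trans (normc_triangleB _ _))// addrC lerD// ltW.
Qed.

Lemma bernoulli_sub x n : 0 <= x <= 1 -> 1 - n%:R * x <= (1 - x) ^+ n.
Proof.
move=> /andP[x0 x1]; elim: n => [|n IH]; first by rewrite expr0 mul0r subr0.
rewrite exprS; apply: (@le_trans _ _ ((1 - x) * (1 - n%:R * x))); last first.
  by rewrite ler_wpM2l// subr_ge0.
have h : 0 <= n%:R * (x * x) by rewrite !mulr_ge0.
rewrite -[n.+1]addn1 natrD; move: (n%:R : R) h => y h; lra.
Qed.

(** 1 - 1/N <= exp(-1/N), and exp(1) >= 2. *)
Lemma pow_le_half N : (0 < N)%N -> (1 - (N%:R : R)^-1) ^+ N <= 2^-1.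
Proof.
move=> N0; have n0 : 0 < (N%:R : R) by rewrite ltr0n.
have n1 : (N%:R : R)^-1 <= 1 by rewrite invf_le1// ler1n.
apply: (@le_trans _ _ (expR (- N%:R^-1) ^+ N)).
  rewrite lerXn2r ?nnegrE ?expR_ge0 ?subr_ge0//.
  exact: expR_ge1Dx.
rewrite -expRM_natl mulrN mulfV ?gt_eqF// expRN lef_pV2 ?posrE ?expR_gt0//.
by have := expR_ge1Dx (1 : R).
Qed.

(** At this radius each block of 8 * [freq n] factors at least halves the power. Term j has at least
    16 (j+1) such blocks against the growth 128^(j+1), so it carries the factor (2^7 / 2^16)^(j+1) =
    512^-(j+1), and these factors sum to at most 1/511. *)
Lemma lac_tail_sum n k :
  \sum_(j < k) amp R (n.+1 + j) * ((freq (n.+1 + j))%:R *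
     (1 - ((8 * freq n)%:R)^-1) ^+ (freq (n.+1 + j)).-1) <= 128 ^+ n / 128 / 511.
Proof.
have N0 : (0 < 8 * freq n)%N by rewrite muln_gt0 freq_gt0.
have half := pow_le_half N0.
have n1 : ((8 * freq n)%:R : R)^-1 <= 1 by rewrite invf_le1 ?ltr0n// ler1n.
have n2 : 0 <= ((8 * freq n)%:R : R)^-1 by rewrite invr_ge0.
move: (_^-1) half n1 n2 => x half n1 n2; set rho := 1 - x in half *.
have rho0 : 0 <= rho by rewrite subr_ge0.
have rho1 : rho <= 1 by rewrite gerBl.
have A0 : 0 <= 128 ^+ n / 128 :> R by rewrite divr_ge0// exprn_ge0.
apply: (@le_trans _ _ (\sum_(j < k) 128 ^+ n / 128 * (512^-1 * 512^-1 ^+ j))).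
  apply: ler_sum => j _; rewrite [leLHS]mulrA amp_freq.
  have -> : 128 ^+ (n.+1 + j) / 128 = 128 ^+ n / 128 * 128 ^+ j.+1 :> R.
    by rewrite addSnnS exprD mulrAC.
  rewrite -exprS -[leLHS]mulrA ler_wpM2l//.
  have -> : 512^-1 ^+ j.+1 = 128 ^+ j.+1 * (2^-1 ^+ 16) ^+ j.+1 :> R.
    by rewrite -exprMn; congr (_ ^+ _); field.
  rewrite ler_wpM2l ?exprn_ge0//.
  apply: (@le_trans _ _ (rho ^+ (8 * freq n * (16 * j.+1)))).
    apply: ler_wiXn2l => //; have := freqD_ge n j.+1; rewrite -addSnnS.
    case: (freq (n.+1 + j)) => // q; rewrite ltnS; apply: leq_trans.
    by rewrite mulnACA -[(8 * 16)%N]/128%N mulnCA mulnA.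
  by rewrite exprM [in leLHS]exprM lerXn2r ?nnegrE ?exprn_ge0// lerXn2r ?nnegrE ?exprn_ge0.
rewrite -mulr_sumr ler_wpM2l// -mulr_sumr.
apply: (@le_trans _ _ (512^-1 * (1 - 512^-1)^-1)).
  apply: ler_wpM2l; first by lra.
  by apply: geometric_sum_le; apply/andP; split; lra.
by rewrite le_eqVlt; apply/orP; left; apply/eqP; field.
Qed.

(* With A = 128^(n+1) / 128, the term of index n + 1 contributes at least A / 16,
   the previous ones at most A / 127 and the next ones at most A / 511. *)
Lemma lac_derive_lower n z0 : let N := (freq n.+1)%:R in
  1 - 2 / N <= normc z0 -> normc z0 <= 1 - (4 * N)^-1 ->
  128 ^+ n.+1 / 4096 <= normc (derive1 (@lac R) z0).
Proof.
move=> N z1 z2.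
have N0 : 0 < N by rewrite ltr0n freq_gt0.
have rho_lt : normc z0 < 1 - ((8 * freq n.+1)%:R)^-1.
  rewrite (le_lt_trans z2)// ltrD2l ltrN2 natrM ltf_pV2 ?posrE ?mulr_gt0//.
  by rewrite ltr_pM2r//; lra.
have rho1 : 1 - ((8 * freq n.+1)%:R)^-1 <= 1 :> R by rewrite gerBl invr_ge0.
have := lac_derive_approx rho1 rho_lt (lac_tail_sum n.+1).
set A := 128 ^+ n.+1 / 128; have A0 : 0 < A by rewrite divr_gt0// exprn_gt0.
rewrite big_ord_recr/=.
set S := \sum_(j < n.+1) _; set M := (amp R n.+1)%:C * _.
have SA : normc S <= A / 127.
  rewrite (le_trans (normc_sum _ _ _))// (@le_trans _ _ (\sum_(j < n.+1) 128 ^+ j / 128))//.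
    apply: ler_sum => j _; rewrite !Normc.normcM normc_real gtr0_norm ?amp_gt0//.
    rewrite -amp_freq ler_wpM2l ?(ltW (amp_gt0 _ _))//.
    have -> : normc ((freq j)%:R : R[i]) = (freq j)%:R.
      by rewrite -(rmorph_nat (real_complex R)) normc_real ger0_norm.
    rewrite ler_piMr// normc_exp exprn_ile1 ?normc_nneg//.
    by rewrite (le_trans (ltW rho_lt)).
  rewrite -mulr_suml /A mulrAC ler_wpM2r// ler_pdivlMr//.
  have -> : 127 = 128 - 1 :> R by ring.
  by rewrite mulrC -subrX1 gerBl.
have NA : A / 16 <= normc M.
  rewrite /M !Normc.normcM normc_real gtr0_norm ?amp_gt0//.
  have -> : normc ((freq n.+1)%:R : R[i]) = (freq n.+1)%:R.
    by rewrite -(rmorph_nat (real_complex R)) normc_real ger0_norm.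
  rewrite mulrA amp_freq -/A ler_pM2l// normc_exp.
  have z01 : normc z0 <= 1 by rewrite (le_trans (ltW rho_lt)).
  apply: (@le_trans _ _ (normc z0 ^+ freq n.+1)); last first.
    by rewrite ler_wiXn2l ?normc_nneg// leq_pred.
  (* Bernoulli's inequality is useless for the full exponent N, as N * 2/N = 2. A quarter of the
     exponent gives 1/2, and the fourth power gives 1/16. *)
  have F4 : freq n.+1 = (64 * freq n * 4)%N by rewrite freqS; lia.
  have N4 : 1 - (64 * freq n)%:R * (2 / N) = 2^-1.
    have f0 : ((freq n)%:R : R) != 0 by rewrite pnatr_eq0 -lt0n freq_gt0.
    by rewrite /N F4 !natrM; field.
  have N01 : 0 <= 2 / N <= 1.
    rewrite divr_ge0 ?(ltW N0)//= ler_pdivrMr// mul1r /N ler_nat freqS.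
    by rewrite (@leq_trans 256)// leq_pmulr// freq_gt0.
  have B := bernoulli_sub (64 * freq n) N01; rewrite N4 in B.
  apply: (@le_trans _ _ ((1 - 2 / N) ^+ freq n.+1)); last first.
    by rewrite lerXn2r ?nnegrE ?normc_nneg// subr_ge0; case/andP: N01.
  rewrite F4 exprM; apply: (@le_trans _ _ (2^-1 ^+ 4)).
    by rewrite le_eqVlt; apply/orP; left; apply/eqP; field.
  by rewrite lerXn2r ?nnegrE// (le_trans _ B).
move=> D; have h1 := normc_triangle_sub M (- S); rewrite opprK normc_opp in h1.
set L := derive1 _ _ in D *.
have h2 := normc_triangle_sub (M + S) (M + S - L).
have e1 : M + S - (M + S - L) = L by ring.
rewrite e1 in h2; rewrite normc_sub (addrC S) in D.
(* 1/16 - 1/127 - 1/511 still exceeds 1/32. *)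
have -> : 128 ^+ n.+1 / 4096 = A / 32 :> R by rewrite /A -mulrA -invfM; congr (_ / _); ring.
move: (normc (M + S)) (normc (M + S - L)) (normc M) (normc S) (normc L) h1 h2 D SA NA.
move: A A0 => A A0 x1 x2 x3 x4 x5; lra.
Qed.

Lemma itv_measure (a b : R) : a < b -> lebesgue_measure (`[a, b]%classic : set R) = (b - a)%:E.
Proof. by move=> ab; rewrite lebesgue_measure_itv/= lte_fin ab EFinB. Qed.

Lemma rectangle_measure (a b c d : R) : a < b -> c < d ->
  mu2 (`[a, b]%classic `*` `[c, d]%classic) = ((b - a) * (d - c))%:E.
Proof.
move=> ab cd; rewrite product_measure1E; [|exact: measurable_itv|exact: measurable_itv].
by rewrite EFinM; congr (_ * _)%E; exact: itv_measure.
Qed.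

(** One rectangle for each n is enough: 128^(2(n+1)) times the area 4096^-(n+1) is 4^(n+1), already
    unbounded without summing over n. *)
Lemma lac_energy_ge : exists c : R, 0 < c /\
  forall n, ((c * 4 ^+ n.+1)%:E <= dirichlet_energy (@lac R))%E.
Proof.
exists (pi^-1 / 4096 ^+ 2); split.
  by apply: divr_gt0; [rewrite invr_gt0 pi_gt0|apply: exprn_gt0; lra].
move=> n.
have [N [NF N256]] : exists N : R, N = (freq n.+1)%:R /\ 256 <= N.
  by exists (freq n.+1)%:R; split=> //; rewrite ler_nat freqS leq_pmulr// freq_gt0.
have N0 : 0 < N by lra.
have NE : N = 256 ^+ n.+1 by rewrite NF freqR.
(* A height N^(-1/2) adds at most 1/N to |z|^2, so |z|^2 <= (1 - 1/N)^2 + 1/N = 1 - 1/N + 1/N^2,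
   still below (1 - 1/(4N))^2. *)
have [h [h0 hE hN]] : exists h : R, [/\ 0 < h, h = 16^-1 ^+ n.+1 & h ^+ 2 = N^-1].
  exists (16^-1 ^+ n.+1); split; [by apply: exprn_gt0; lra|by []|].
  by rewrite NE -exprM mulnC exprM -exprVn; congr (_ ^+ _); field.
have N1 : N^-1 <= 256^-1 by rewrite lef_pV2 ?posrE; lra.
have N2 : 0 < N^-1 by rewrite invr_gt0.
have N4 : 0 < (4 * N)^-1 by rewrite invr_gt0; apply: mulr_gt0; lra.
pose x1 := 1 - 2 / N; pose x2 := 1 - N^-1.
have x12 : x1 < x2 by rewrite /x1 /x2; lra.
pose Q : set (R * R) := `[x1, x2]%classic `*` `[0, h]%classic.
have mQ : mu2 Q = (N^-1 * h)%:E.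
  by rewrite rectangle_measure//; congr (_%:E); rewrite /x1 /x2; ring.
have Qz p : Q p -> 1 - 2 / N <= normc (p.1 +i* p.2) /\ normc (p.1 +i* p.2) <= 1 - (4 * N)^-1.
  case: p => x y [] /=; rewrite !in_itv/= => /andP[xl xr] /andP[yl yr].
  split.
    rewrite (le_trans xl)// (le_trans (ler_norm _))//.
    exact: (Re_le_normc (x +i* y)).
  rewrite -(ler_pXn2r (n := 2)) ?nnegrE ?normc_nneg//; last first.
    by rewrite subr_ge0 invfM; lra.
  rewrite normc_sqr.
  have x0 : 0 <= x by rewrite (le_trans _ xl)// /x1; lra.
  have xx : x ^+ 2 <= x2 ^+ 2 by rewrite lerXn2r ?nnegrE// (le_trans x0).
  have yy : y ^+ 2 <= N^-1 by rewrite -hN lerXn2r ?nnegrE// ltW.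
  apply: (le_trans (lerD xx yy)); rewrite /x2 invfM.
  move: (N^-1) N1 N2 => a a1 a0.
  have -> : (1 - 4^-1 * a) ^+ 2 = 1 - a / 2 + a ^+ 2 / 16 by field.
  have -> : (1 - a) ^+ 2 = 1 - a * 2 + a * a by ring.
  have h1 : a * a <= 256^-1 * a by apply: ler_wpM2r => //; exact: ltW.
  have h2 : 0 <= a ^+ 2 / 16 by apply: divr_ge0; [exact: sqr_ge0|lra].
  by move: (a ^+ 2) (a * a) h1 h2 => b c; lra.
have key : pi^-1 / 4096 ^+ 2 * 4 ^+ n.+1 = pi^-1 * ((128 ^+ n.+1 / 4096) ^+ 2 * (N^-1 * h)).
  have e1 : (128 ^+ n.+1) ^+ 2 = 4 ^+ n.+1 * 4096 ^+ n.+1 :> R.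
    by rewrite -exprM mulnC exprM -exprMn; congr (_ ^+ _); ring.
  have e2 : N^-1 * h = (4096 ^+ n.+1)^-1.
    by rewrite NE hE -!exprVn -exprMn; congr (_ ^+ _); field.
  rewrite e2 expr_div_n e1.
  have X0 : 4096 ^+ n.+1 != 0 :> R by apply: lt0r_neq0; apply: exprn_gt0; lra.
  move: (4096 ^+ n.+1) X0 (4 ^+ n.+1) (pi^-1) => X X0 Y p.
  by field.
rewrite key /dirichlet_energy /area_integral EFinM.
apply: lee_wpmul2l; first by rewrite lee_fin invr_ge0 pi_ge0.
have c0 : 0 <= 128 ^+ n.+1 / 4096 :> R by apply: divr_ge0; [apply: exprn_ge0|]; lra.
have := @integral_ge_cst _ _ R mu2 [set p : R * R | disk (p.1 +i* p.2)] Q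
  (fun p => ((normc (derive1 (@lac R) (p.1 +i* p.2))) ^+ 2)%:E) ((128 ^+ n.+1 / 4096) ^+ 2).
move=> H; apply: (le_trans _ (H _ _ _ _ _)).
- by rewrite [X in (_ * X)%E](_ : _ = (N^-1 * h)%:E).
- by apply: measurableX; exact: measurable_itv.
- move=> p /Qz[_]; rewrite /disk/= => /le_lt_trans; apply.
  by rewrite gtrBl.
- exact: sqr_ge0.
- by move=> p _; rewrite lee_fin sqr_ge0.
- move=> p /Qz[]; rewrite NF => h1 h2; rewrite lee_fin.
  by apply: lerXn2r; [rewrite nnegrE|rewrite nnegrE normc_nneg|exact: lac_derive_lower h1 h2].
Qed.

Lemma lac_energy_infinite : dirichlet_energy (@lac R) = +oo%E.
Proof.
have E0 : (0 <= dirichlet_energy (@lac R))%E.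
  rewrite mule_ge0 ?lee_fin ?invr_ge0 ?pi_ge0//.
  by apply: integral_ge0 => p _; rewrite lee_fin sqr_ge0.
apply/eqP; rewrite -leye_eq leNgt; apply/negP => Efin.
have := Efin; rewrite -ge0_fin_numE// => /fineK.
set F := fine _ => EF; have [c [c0 H]] := lac_energy_ge.
have F0 : 0 <= F by rewrite -lee_fin EF.
have := H (Num.truncn (F / c)); rewrite -EF lee_fin mulrC -ler_pdivlMr//.
have /andP[_] : (Num.truncn (F / c))%:R <= F / c < (Num.truncn (F / c)).+1%:R.
  by apply: truncn_itv; rewrite divr_ge0// ltW.
move: (Num.truncn _) => m mF /le_lt_trans/(_ mF); rewrite -natrX ltr_nat => mm.
by have := ltn_trans (ltn_expl m.+1 (isT : (1 < 4)%N)) mm; rewrite ltnn.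
Qed.

(** The test function against boundedness. Its derivative is 1, and enclosing the disk in the square
    [-1, 1]^2 bounds the energy by 4 / pi. *)
Lemma dirichlet_star_id : dirichlet_star (fun z : R[i] => z).
Proof.
have idE z : derive1 (fun z : R[i] => z) z = 1.
  apply: (@derive1_eq_slope _ _ (fun=> 1) _ 1) => //; first exact: jet_cst.
  by move=> w _; rewrite mulr1 addrC subrK.
split=> //; split.
  by apply: smooth_analytic => z _ n; exact: jet_id.
rewrite /dirichlet_energy /area_integral.
pose Q : set (R * R) := `[-1, 1]%classic `*` `[-1, 1]%classic.
have := @integral_le_cst _ _ R mu2 [set p : R * R | disk (p.1 +i* p.2)] Q
  (fun p => ((normc (derive1 (fun z : R[i] => z) (p.1 +i* p.2))) ^+ 2)%:E) 1.
move=> H; apply: (@le_lt_trans _ _ (pi^-1 * (1 * ((1 - -1) * (1 - -1))))%:E); last exact: ltry.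
rewrite EFinM; apply: lee_wpmul2l; first by rewrite lee_fin invr_ge0 pi_ge0.
apply: (le_trans (H _ _ _ _)) => //.
- by apply: measurableX; exact: measurable_itv.
- move=> [x y] /= /ltW xy; rewrite /Q/= !in_itv/= -!ler_norml.
  by split; rewrite (le_trans _ xy)//; [exact: (Re_le_normc (x +i* y))|exact: (Im_le_normc (x +i* y))].
- by move=> p _; rewrite !lee_fin idE Normc.normc1 expr1n ler01 lexx.
- rewrite [X in (_ * X)%E](_ : _ = ((1 - -1) * (1 - -1))%:E) -?EFinM//.
  by apply: rectangle_measure; lra.
Qed.

End energy.

(* The target of C_phi is D rather than D_*, so that unboundedness is not a
   mere consequence of phi 0 <> 0; when phi 0 = 0 the two coincide. *)
Theorem theorem2p6 (R : realType) :
  exists phi : complex R -> complex R,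
    [/\ schur phi,
        compact_operator (hardy_orlicz psi2) (hardy_orlicz_norm psi2)
          (composition_operator phi) &
        ~ bounded_operator dirichlet_star dirichlet dirichlet_norm
            dirichlet_norm (composition_operator phi)].
Proof.
have lac64 z : normc z <= 1 -> normc (@lac R z) <= 64^-1 by exact: lac_bound.
exists (@lac R); split.
- split=> [|z /ltW /lac64 h]; first exact/smooth_analytic/lac_smooth.
  by rewrite /disk/= (le_lt_trans h)//; lra.
- exact: composition_compact (@lac_smooth R) (@lac_continuous R) lac64.
(* The contradiction comes from membership in the target, not from the norm inequality: [fine] sends
   an infinite energy to 0, so [dirichlet_norm] would not detect it. *)
move=> [K /(_ _ (dirichlet_star_id R))[[_]]].
by rewrite [X in dirichlet_energy X](_ : _ = @lac R)// lac_energy_infinite ltxx.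
Qed.
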